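(* Let $L=\mathrm{Lie}(G)$ be the Lie algebra of a compact semisimple Lie group $G$. Let $C$ be a Cartan subalgebra of $L$ and let $C^{\perp}$ be the orthogonal complement of $C$ in $L$ with respect to the negative of the Killing form of $L$. Then the $G$-orbit of $C^{\perp}$ is all of $L$, i.e. $L=\bigcup_{g\in G} g.C^{\perp}$.
   Context: $G$ acts on $L$ by the adjoint action, $g.x=\mathrm{Ad}(g)(x)$. In the Lie algebra of a compact semisimple Lie group, Cartan subalgebras are the same as maximal toral (maximal abelian) subalgebras. *)

(* Defs.v *)
From HB Require Import structures.
From mathcomp Require Import all_boot all_order all_algebra.
From mathcomp Require Import all_classical all_reals all_analysis.

Set Implicit Arguments.
Unset Strict Implicit.
Unset Printing Implicit Defensive.

Import Order.TTheory GRing.Theory Num.Theory.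
Import numFieldNormedType.Exports.

Local Open Scope classical_set_scope.
Local Open Scope ring_scope.

(* C^k functions on an open set U of a finite-dimensional space V: f is C^k.+1
   when it is differentiable on U and all its directional derivatives are C^k.
   Only meant for U open, so that 'D_v f on U depends on f on U only. *)
Fixpoint Ck_on (R : realType) (V W : normedModType R) (k : nat)
    (U : set V) (f : V -> W) : Prop :=
  match k with
  | 0 => {within U, continuous f}
  | k'.+1 => (forall x, U x -> differentiable f x) /\
             (forall v : V, Ck_on k' U ('D_v f))
  end.

Definition smooth_on (R : realType) (V W : normedModType R)
    (U : set V) (f : V -> W) : Prop :=
  forall k : nat, Ck_on k U f.

(* A homeomorphism from an open set of M to an open set of R^n. The maps
   [coord] and [param] are total; their values outside [dom] and
   [coord @` dom] are irrelevant. *)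
Record chart (R : realType) (n : nat) (M : topologicalType) := Chart {
  dom : set M ;
  coord : M -> 'rV[R]_n ;
  param : 'rV[R]_n -> M ;
  dom_open : open dom ;
  codom_open : open (coord @` dom) ;
  coord_continuous : {within dom, continuous coord} ;
  param_continuous : {within coord @` dom, continuous param} ;
  coordK : forall p, dom p -> param (coord p) = p
}.

(* Real Lie groups of dimension n: a group with a Hausdorff second countable
   topology and a smooth atlas (not required to be maximal) for which
   multiplication and inversion are smooth maps, i.e. continuous, and smooth
   when read in charts. *)
HB.mixin Record isLieGroup (R : realType) (n : nat) G
    of Topological G & Group G := {
  atlas : set (chart R n G) ;
  lie_hausdorff : hausdorff_space G ;
  lie_second_countable : @second_countable G ;
  atlas_cover : forall p : G, exists2 a, atlas a & dom a p ;
  atlas_compat : forall a b, atlas a -> atlas b ->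
    smooth_on (coord a @` (dom a `&` dom b)) (fun u => coord b (param a u)) ;
  lie_mul_continuous : continuous (fun p : G * G => (p.1 * p.2)%g) ;
  lie_inv_continuous : continuous (fun p : G => (p^-1)%g) ;
  lie_mul_smooth : forall a b c, atlas a -> atlas b -> atlas c ->
    smooth_on
      [set (coord a p.1, coord b p.2) |
         p in [set p : G * G | [/\ dom a p.1, dom b p.2 & dom c (p.1 * p.2)%g]]]
      (fun u : 'rV[R]_n * 'rV[R]_n => coord c (param a u.1 * param b u.2)%g) ;
  lie_inv_smooth : forall a b, atlas a -> atlas b ->
    smooth_on (coord a @` [set p | dom a p /\ dom b (p^-1)%g])
      (fun u => coord b ((param a u)^-1)%g)
}.

#[short(type="lieGroupType")]
HB.structure Definition LieGroup (R : realType) (n : nat) :=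
  {G of isLieGroup R n G & Topological G & Group G}.

(* The Lie algebra of G is the tangent space at 1, identified with 'rV[R]_n
   through a chart a around 1: a row vector X stands for the tangent vector
   with coordinates X in a. *)
Section LieAlgebraOfLieGroup.
Variables (R : realType) (n : nat) (G : lieGroupType R n) (a : chart R n G).
Notation V := 'rV[R]_n.

(* The left-invariant vector field with value X at 1, read in the chart a: at
   the point of coordinates u it is the image of X by the differential at 1 of
   the left translation by [param a u]. *)
Definition left_invariant_field (X : V) : V -> V :=
  fun u => 'd (fun v => coord a (param a u * param a v)%g) (coord a 1%g) X.

(* The bracket of vector fields on an open set of R^n,
   [X, Y]^i = \sum_j (X^j d_j Y^i - Y^j d_j X^i). *)
Definition field_bracket (X Y : V -> V) : V -> V :=
  fun u => 'D_(X u) Y u - 'D_(Y u) X u.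

Definition lie_bracket (X Y : V) : V :=
  field_bracket (left_invariant_field X) (left_invariant_field Y) (coord a 1%g).

(* Ad g is the differential at 1 of the conjugation x |-> g x g^-1. *)
Definition Ad (g : G) (X : V) : V :=
  'd (fun u => coord a (g * param a u * g^-1)%g) (coord a 1%g) X.

End LieAlgebraOfLieGroup.

Section LieAlgebra.
Variables (F : fieldType) (n : nat).
Notation L := 'rV[F]_n.
Variable br : L -> L -> L.

(* The span of all br x y with x in A and y in B; since br is bilinear in all
   uses, basis vectors suffice (compare prodv). *)
Definition brv (A B : {vspace L}) : {vspace L} :=
  <<[seq br x y | x <- vbasis A, y <- vbasis B]>>%VS.

Definition ideal (I : {vspace L}) : Prop :=
  forall x y, y \in I -> br x y \in I.

Definition subalgebra (A : {vspace L}) : Prop :=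
  forall x y, x \in A -> y \in A -> br x y \in A.

Definition solvable_subalgebra (A : {vspace L}) : Prop :=
  exists k, iter k (fun B => brv B B) A = 0%VS.

Definition nilpotent_subalgebra (A : {vspace L}) : Prop :=
  exists k, iter k (brv A) A = 0%VS.

Definition semisimple : Prop :=
  forall I : {vspace L}, ideal I -> solvable_subalgebra I -> I = 0%VS.

Definition cartan_subalgebra (C : {vspace L}) : Prop :=
  [/\ subalgebra C,
      nilpotent_subalgebra C &
      forall x, (forall c, c \in C -> br x c \in C) -> x \in C].

Definition killing (x y : L) : F := \tr (lin1_mx (br x \o br y)).

Definition killing_orth (C : {vspace L}) : set L :=
  [set x | forall c, c \in C -> - killing x c = 0].

End LieAlgebra.

(* Main.v *)
Require Import Defs.
From HB Require Import structures.
From mathcomp Require Import all_boot all_order all_algebra.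
From mathcomp Require Import all_classical all_reals all_analysis.
From mathcomp Require Import ring lra.

(** Why the theorem is true.  Let K be the negative of the Killing form and P
the K-orthogonal projection onto C.  Given x, the continuous function
g |-> K(P(Ad g x), P(Ad g x)) attains its minimum on the compact group G; let
y = Ad g x at a minimum and p = P y.  It suffices to show p = 0: then y is
orthogonal to C and x = Ad g^-1 y.

Moving g by elements h near 1 with tangent vector z, the first variation gives
K(p, [z, y]) = 0 for all z, that is [p, y] = 0.  Adding the variations along h
and h^-1, the second one gives
   0 <= K(p, [z, [z, y]]) + K(P[z, y], P[z, y])   for all z.
Since (Ad h - 1) + (Ad h^-1 - 1) = - (Ad h - 1) (Ad h^-1 - 1), this requires
the first derivative of Ad at 1 only.  If z is orthogonal to the kernel of
ad p, then P[z, y] = 0, because C is abelian and ad y commutes with ad p.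
Splitting an arbitrary z along ker (ad p) and its orthogonal yields
K(z, [p, [y, z]]) >= 0 for every z.  So the trace of ad p ad y is nonnegative,
that is K(p, p) = K(p, y) <= 0, and p = 0.

Four ingredients support this argument.

- The differential of u |-> Ad(u) Y at 1 in the direction X is [X, Y]
  ([diff_Ad_coord]).  The bracket is read off the mixed second derivatives of
  the multiplication in a chart, and the identity rests on their symmetry
  ([derive_sym]).  Hence Ad acts by automorphisms of the bracket
  ([Ad_lie_bracket]), and the Jacobi identity follows ([jacobi]).

- A bounded group of matrices preserves an inner product ([invariant_form]).
  Instead of averaging over the group, one minimises over inner products the
  largest Frobenius norm along the orbit; strict convexity makes the minimiser
  unique, hence invariant.

- For an invariant inner product every ad x is skew, so the trace of (ad x)^2
  is at most 0, with equality only if x is central, that is x = 0 by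
  semisimplicity: K is positive definite ([killing_posdef]).

- A nilpotent subalgebra, such as C, of an algebra with an invariant inner
  product is abelian ([nilpotent_abelian]).  *)

Set Implicit Arguments.
Unset Strict Implicit.
Unset Printing Implicit Defensive.

Import Order.TTheory GRing.Theory Num.Theory.
Import numFieldNormedType.Exports.
(* Makes [coord], [coordK] and [coord_continuous] refer to charts. *)
Import Defs.

Local Open Scope classical_set_scope.
Local Open Scope ring_scope.

(** * Differentials *)

Lemma near_eq_differentiable (R : realType) (V W : normedModType R)
    (f g : V -> W) (x : V) :
  {near x, f =1 g} -> differentiable f x -> differentiable g x.
Proof.
move=> fg df.
have dgE : g \o shift x = cst (g x) + 'd f x +o_ 0 id.
  have /diff_locally/eqaddoP dfE := df.
  apply/eqaddoP => e e0; have /= := dfE e e0.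
  have /nbhs0P := fg.
  apply: filterS2 => h /= fgh.
  rewrite -![(_ - _ : _ -> _) _]/(_ - _) /= [h + x]addrC fgh.
  by rewrite -![(_ + _ : _ -> _) _]/(_ + _) /cst /= (nbhs_singleton fg).
apply/diff_locallyP.
have -> := diff_unique (diff_continuous df) dgE.
by split => //; exact: diff_continuous.
Qed.

Lemma near_eq_diff (R : realType) (V W : normedModType R)
    (f g : V -> W) (x v : V) :
  {near x, f =1 g} -> differentiable f x -> 'd f x v = 'd g x v.
Proof.
move=> fg df; rewrite -deriveE // -deriveE; last exact: near_eq_differentiable df.
exact: near_eq_derive.
Qed.

Lemma diff_compE (R : realType) (U V W : normedModType R) (f : U -> V)
    (g : V -> W) (x v : U) :
  differentiable f x -> differentiable g (f x) ->
  'd (g \o f) x v = 'd g (f x) ('d f x v).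
Proof. by move=> df dg; rewrite diff_comp. Qed.

Lemma differentiable_slice (R : realType) (U V1 V2 W : normedModType R)
    (f : U -> V1) (g : U -> V2) (k : V1 * V2 -> W) (x : U) :
  differentiable f x -> differentiable g x -> differentiable k (f x, g x) ->
  differentiable (fun u => k (f u, g u)) x.
Proof.
move=> df dg dk; have dp := differentiable_pair df dg.
exact: (differentiable_comp dp dk).
Qed.

Lemma diff_slice (R : realType) (U V1 V2 W : normedModType R)
    (f : U -> V1) (g : U -> V2) (k : V1 * V2 -> W) (x v : U) :
  differentiable f x -> differentiable g x -> differentiable k (f x, g x) ->
  'd (fun u => k (f u, g u)) x v = 'd k (f x, g x) ('d f x v, 'd g x v).
Proof.
move=> df dg dk; have dp := differentiable_pair df dg.
by apply: etrans (diff_compE _ dp dk) _; rewrite diff_pair.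
Qed.

Lemma diff_idE (R : realType) (V : normedModType R) (x v : V) :
  'd (fun u : V => u) x v = v.
Proof. by have -> := @diff_val _ _ _ _ _ _ _ (is_diff_id x). Qed.

Lemma diff_cstE (R : realType) (V W : normedModType R) (y : W) (x v : V) :
  'd (fun=> y) x v = 0.
Proof. by rewrite diff_cst. Qed.

(** The lemmas prefixed [diff_slice] read the differential of [k (f u, g u)],
with constant or identical components, off ['d k]; they serve for [k] the group
law in a chart, differentiated in one variable at a time. *)
Lemma diff_slice_left (R : realType) (U V1 V2 W : normedModType R)
    (f : U -> V1) (y : V2) (k : V1 * V2 -> W) (x v : U) :
  differentiable f x -> differentiable k (f x, y) ->
  differentiable (fun u => k (f u, y)) x /\
  'd (fun u => k (f u, y)) x v = 'd k (f x, y) ('d f x v, 0).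
Proof.
move=> df dk; have dc : differentiable (fun _ : U => y) x by exact: ex_diff.
split; first exact: (differentiable_slice df dc dk).
by apply: etrans (diff_slice v df dc dk) _; rewrite diff_cstE.
Qed.

Lemma diff_slice_right (R : realType) (U V1 V2 W : normedModType R)
    (y : V1) (g : U -> V2) (k : V1 * V2 -> W) (x v : U) :
  differentiable g x -> differentiable k (y, g x) ->
  differentiable (fun u => k (y, g u)) x /\
  'd (fun u => k (y, g u)) x v = 'd k (y, g x) (0, 'd g x v).
Proof.
move=> dg dk; have dc : differentiable (fun _ : U => y) x by exact: ex_diff.
split; first exact: (differentiable_slice dc dg dk).
by apply: etrans (diff_slice v dc dg dk) _; rewrite diff_cstE.
Qed.

Lemma diff_linear_comp (R : realType) (U V W : normedModType R)
    (L : {linear V -> W}) (f : U -> V) (x v : U) :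
  continuous L -> differentiable f x ->
  differentiable (L \o f) x /\ 'd (L \o f) x v = L ('d f x v).
Proof.
move=> Lc df; have dL : differentiable L (f x) by exact: linear_differentiable.
split; first exact: differentiable_comp.
by rewrite diff_compE // diff_lin.
Qed.

Lemma differentiable_idfun (R : realType) (V : normedModType R) (x : V) :
  differentiable (fun u : V => u) x.
Proof. exact: ex_diff. Qed.

Lemma diff_slice_left_id (R : realType) (V1 V2 W : normedModType R)
    (y : V2) (k : V1 * V2 -> W) (x v : V1) :
  differentiable k (x, y) ->
  differentiable (fun u => k (u, y)) x /\
  'd (fun u => k (u, y)) x v = 'd k (x, y) (v, 0).
Proof.
move=> dk; have [ds dE] := diff_slice_left v (differentiable_idfun x) dk.
by split => //; apply: etrans dE _; rewrite diff_idE.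
Qed.

Lemma diff_slice_right_id (R : realType) (V1 V2 W : normedModType R)
    (y : V1) (k : V1 * V2 -> W) (x v : V2) :
  differentiable k (y, x) ->
  differentiable (fun u => k (y, u)) x /\
  'd (fun u => k (y, u)) x v = 'd k (y, x) (0, v).
Proof.
move=> dk; have [ds dE] := diff_slice_right v (differentiable_idfun x) dk.
by split => //; apply: etrans dE _; rewrite diff_idE.
Qed.

Lemma diff_slice_id (R : realType) (V1 V2 W : normedModType R)
    (g : V1 -> V2) (k : V1 * V2 -> W) (x v : V1) :
  differentiable g x -> differentiable k (x, g x) ->
  differentiable (fun u => k (u, g u)) x /\
  'd (fun u => k (u, g u)) x v = 'd k (x, g x) (v, 'd g x v).
Proof.
move=> dg dk; have di := differentiable_idfun x.
split; first exact: (differentiable_slice di dg dk).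
by apply: etrans (diff_slice v di dg dk) _; rewrite diff_idE.
Qed.

Lemma diff_eq_id (R : realType) (V : normedModType R) (f : V -> V) (x v : V) :
  {near x, f =1 (fun u => u)} -> 'd f x v = v.
Proof.
move=> e; rewrite -{2}[v](diff_idE x); apply/esym/near_eq_diff.
  by apply: filterS e => u ->.
exact: differentiable_idfun.
Qed.

Lemma diff_estimate (R : realType) (V W : normedModType R) (f : V -> W) (x : V)
    (e : R) : differentiable f x -> 0 < e ->
  \forall h \near (0 : V), `|f (x + h) - f x - 'd f x h| <= e * `|h|.
Proof.
move=> /diff_locally/eqaddoP dfE e0; have /= := dfE e e0.
apply: filterS => h /=; rewrite -![(_ - _ : _ -> _) _]/(_ - _) /=.
rewrite -![(_ + _ : _ -> _) _]/(_ + _) /cst /=.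
by rewrite opprD addrA addrC [h + x]addrC [- _ + _]addrC.
Qed.

(** * Symmetry of second derivatives *)

Section Schwarz.
Variables (R : realType) (V : normedModType R) (f : V -> R) (x0 : V).
Hypothesis df : \forall x \near x0, differentiable f x.

Let second_difference v w (h : R) :=
  f (x0 + h *: v + h *: w) - f (x0 + h *: v) - f (x0 + h *: w) + f x0.

(** The mean value theorem for [s |-> f (x0 + s v + h w) - f (x0 + s v)] writes
the second difference as [h] times an increment of ['D_v f], which the
differentiability of ['D_v f] at [x0] estimates up to [o(h)]. *)
Lemma second_difference_estimate v w (e : R) :
  differentiable ('D_v f) x0 -> 0 < e ->
  \forall h \near 0^'+,
    `|second_difference v w h - h ^+ 2 * 'D_w ('D_v f) x0|
      <= e * (2 * `|v| + `|w|) * h ^+ 2.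
Proof.
move=> dg e0.
have /nbhs_normP[r1 /= r10 Hr1] := df.
have /nbhs_normP[r2 /= r20 Hr2] := diff_estimate dg e0.
(* M exceeds |v| + |w|, so that hM < r keeps the whole parallelogram with
   sides hv and hw inside the ball of radius r. *)
pose r := Num.min r1 r2; have r0 : 0 < r by rewrite lt_min r10.
pose M := `|v| + `|w| + 1; have M0 : 0 < M by rewrite ltr_pwDr.
near=> h.
have h0 : 0 < h by near: h; exact: nbhs_right_gt.
have hr : h * M < r.
  by rewrite -ltr_pdivlMr //; near: h; apply: nbhs_right_lt; rewrite divr_gt0.
have small (a b : R) : 0 <= a <= h -> 0 <= b <= h -> `|a *: v + b *: w| < r.
  move=> /andP[a0 ah] /andP[b0 bh]; apply: le_lt_trans hr.
  rewrite (le_trans (ler_normD _ _)) // !normrZ !ger0_norm // /M.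
  rewrite mulrDr mulrDr -addrA lerD // ?ler_wpM2r //.
  by rewrite -[leLHS]addr0 lerD // ?ler_wpM2r // mulr1 ltW.
have dfs (a b : R) : 0 <= a <= h -> 0 <= b <= h ->
    differentiable f (x0 + (a *: v + b *: w)).
  move=> /small /[apply] abr; apply: Hr1 => /=.
  by rewrite /ball_ /= opprD addNKr normrN (lt_le_trans abr) // ge_min lexx.
pose phi (s : R) : R := f (x0 + (s *: v + h *: w)) - f (x0 + (s *: v + 0 *: w)).
pose dphi (s : R) : R := 'D_v f (x0 + (s *: v + h *: w)) - 'D_v f (x0 + (s *: v + 0 *: w)).
have phiD (s : R) : 0 <= s <= h -> is_derive s 1 phi (dphi s).
  move=> sh.
  have line (b : R) : 0 <= b <= h ->
      is_derive s 1 (fun s => f (x0 + (s *: v + b *: w)))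
        ('D_v f (x0 + (s *: v + b *: w))).
    move=> bh; have dfb := dfs _ _ sh bh.
    have dl : is_diff s (fun s : R => x0 + (s *: v + b *: w))
        (0 + (( *:%R^~ v) + 0)).
      by apply: is_diffD.
    have dc : differentiable (f \o (fun s : R => x0 + (s *: v + b *: w))) s.
      by apply: differentiable_comp.
    apply: DeriveDef; first exact: diff_derivable.
    rewrite deriveE // diff_comp // [in LHS]/= diff_val deriveE //.
    by congr ('d f _ _); rewrite -![(_ + _ : _ -> _) _]/(_ + _) /= add0r addr0 scale1r.
  apply: is_deriveB; first by apply: line; rewrite lexx ltW.
  by apply: line; rewrite lexx ltW.
have phic : {within `[0, h], continuous phi}.
  by apply: derivable_within_continuous => s; rewrite in_itv /= => /phiD[].
have phid (s : R) : s \in `]0, h[ -> is_derive s 1 phi (dphi s).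
  by rewrite in_itv /= => /andP[s0 sh]; apply: phiD; rewrite !ltW.
have [s] := MVT h0 phid phic; rewrite in_itv /= => /andP[s0 sh] phiE.
have {s0 sh}sh : 0 <= s <= h by rewrite !ltW.
have -> : second_difference v w h = dphi s * h.
  rewrite subr0 in phiE; rewrite -phiE /second_difference /phi.
  by rewrite !scale0r !addr0 add0r !addrA; ring.
have hh : 0 <= h <= h by rewrite lexx (ltW h0).
have h00 : (0 : R) <= 0 <= h by rewrite (lexx 0) (ltW h0).
have est (b : R) : 0 <= b <= h -> `|'D_v f (x0 + (s *: v + b *: w)) - 'D_v f x0 -
    'd ('D_v f) x0 (s *: v + b *: w)| <= e * `|s *: v + b *: w|.
  move=> bh; apply: Hr2 => /=.
  by rewrite /ball_ /= sub0r normrN (lt_le_trans (small _ _ sh bh)) // ge_min lexx orbT.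
have e1 := est 0 h00; have e2 := est h hh.
rewrite scale0r addr0 linearZ /= in e1; rewrite linearD !linearZ /= in e2.
rewrite deriveE //.
set dw : R := 'd _ x0 w in e1 e2 *; set dv : R := 'd _ x0 v in e1 e2.
rewrite -[X in `|X|]/((dphi s * h - h ^+ 2 * dw) : R).
have -> : dphi s * h - h ^+ 2 * dw = (dphi s - h * dw) * h by ring.
have -> : e * (2 * `|v| + `|w|) * h ^+ 2 = (e * (2 * `|v| + `|w|) * h) * h.
  by ring.
rewrite normrM (gtr0_norm h0) ler_pM2r // /dphi scale0r addr0.
set A : R := 'D_v f _ in e2 *; set B : R := 'D_v f _ in e1 *.
set C : R := 'D_v f x0 in e1 e2.
have -> : A - B - h * dw = (A - C - (s *: dv + h *: dw)) - (B - C - s *: dv).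
  by rewrite /GRing.scale /=; ring.
apply: le_trans (ler_normB _ _) _; apply: le_trans (lerD e2 e1) _.
rewrite -mulrDr -!mulrA ler_pM2l //.
apply: (@le_trans _ _ ((h * `|v| + h * `|w|) + h * `|v|)); last by lra.
have /andP[s0 sh'] := sh.
rewrite lerD // ?(le_trans (ler_normD _ _)) ?lerD // normrZ ger0_norm ?(ltW h0) //.
all: by rewrite ler_wpM2r.
Unshelve. all: by end_near. Qed.

(** Schwarz's theorem: the second difference is symmetric in [v] and [w], and
divided by [h ^+ 2] it tends to either iterated derivative. *)
Lemma derive_sym v w :
  differentiable ('D_v f) x0 -> differentiable ('D_w f) x0 ->
  'D_w ('D_v f) x0 = 'D_v ('D_w f) x0.
Proof.
move=> dv dw; apply/eqP; rewrite -subr_eq0 -normr_le0; apply/ler_addgt0Pl => e e0.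
pose M := (2 * `|v| + `|w|) + (2 * `|w| + `|v|) + 1.
have M0 : 0 < M by rewrite ltr_wpDl // !addr_ge0 // mulr_ge0.
have eM0 : 0 < e / M by rewrite divr_gt0.
near (0 : R)^'+ => h.
have h0 : 0 < h by near: h; exact: nbhs_right_gt.
have e1 : `|second_difference v w h - h ^+ 2 * 'D_w ('D_v f) x0|
  <= e / M * (2 * `|v| + `|w|) * h ^+ 2.
  by near: h; exact: second_difference_estimate.
have e2 : `|second_difference w v h - h ^+ 2 * 'D_v ('D_w f) x0|
  <= e / M * (2 * `|w| + `|v|) * h ^+ 2.
  by near: h; exact: second_difference_estimate.
have sdC : second_difference w v h = second_difference v w h.
  rewrite /second_difference [x0 + _ + h *: v]addrAC; ring.
rewrite sdC in e2; have h20 : 0 < h ^+ 2 by rewrite exprn_gt0.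
set a : R := 'D_w _ _ in e1 *; set b : R := 'D_v _ _ in e2 *.
rewrite addr0 -(ler_pM2r h20) -[X in _ * X](gtr0_norm h20) -normrM.
have -> : (a - b) * h ^+ 2 = (second_difference v w h - h ^+ 2 * b) -
  (second_difference v w h - h ^+ 2 * a) by ring.
apply: le_trans (ler_normB _ _) _; apply: le_trans (lerD e2 e1) _.
rewrite -mulrDl -mulrDr ler_pM2r // mulrAC ler_pdivrMr // ler_pM2l // /M.
by rewrite addrC -[leLHS]addr0 lerD.
Unshelve. all: by end_near. Qed.

End Schwarz.

Lemma differentiable_entry (R : realType) (V : normedModType R) k
    (f : V -> 'rV[R]_k) x j :
  differentiable f x -> differentiable (fun u => f u 0 j : R) x.
Proof.
move=> df.
have dc := differentiable_coord (f x) 0 j.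
exact: (differentiable_comp df dc).
Qed.

Lemma derive_entry (R : realType) (V : normedModType R) k
    (f : V -> 'rV[R]_k) x v j :
  differentiable f x -> ('D_v f x) 0 j = 'D_v (fun u => f u 0 j : R) x.
Proof.
move=> df.
have dv := @diff_derivable _ _ _ f x v df.
by rewrite (derive_mx dv) mxE.
Qed.

Lemma derive_sym_rV (R : realType) (V : normedModType R) k
    (f : V -> 'rV[R]_k) (x0 v w : V) :
  (\forall x \near x0, differentiable f x) ->
  differentiable ('D_v f) x0 -> differentiable ('D_w f) x0 ->
  'D_w ('D_v f) x0 = 'D_v ('D_w f) x0.
Proof.
move=> df dv dw; apply/rowP => j.
apply: (etrans (derive_entry w j dv)).
apply: (etrans _ (esym (derive_entry v j dw))).
have E z : {near x0, (fun u => 'D_z f u 0 j) =1 'D_z (fun u => f u 0 j : R)}.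
  by apply: filterS df => u du; rewrite (derive_entry z j du).
rewrite (near_eq_derive _ (E v)) (near_eq_derive _ (E w)).
apply: derive_sym.
- by apply: filterS df => u; exact: differentiable_entry.
- exact: near_eq_differentiable (E v) (differentiable_entry j dv).
- exact: near_eq_differentiable (E w) (differentiable_entry j dw).
Qed.

(** * Product rule for scaling *)

Lemma scale_is_bilinear (R : realType) (W : normedModType R) :
  bilinear_for
    (GRing.Scale.Law.clone _ _ *:%R _) (GRing.Scale.Law.clone _ _ *:%R _)
    (@GRing.scale R W : R -> W -> W).
Proof.
split=> [u'|u] b x y /=; first by rewrite scalerDl scalerA.
by rewrite scalerDr !scalerA mulrC.
Qed.

HB.instance Definition _ (R : realType) (W : normedModType R) :=
  bilinear_isBilinear.Build R R W W _ _ (@GRing.scale R W : R -> W -> W)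
    (scale_is_bilinear W).

Lemma is_diff_scale (R : realType) (V W : normedModType R)
    (k dk : V -> R) (f df : V -> W) (x : V) :
  is_diff x k dk -> is_diff x f df ->
  is_diff x (fun u => k u *: f u) (fun v => k x *: df v + dk v *: f x).
Proof.
move=> dkP dfP.
have sc : continuous (fun p : R * W => p.1 *: p.2) by exact: scale_continuous.
have ds := differentiable_bilin (f := GRing.scale : R -> W -> W) (k x, f x) sc.
pose kf u := (k u, f u).
have dkf : differentiable kf x by apply: differentiable_pair.
have -> : (fun u => k u *: f u) = (fun p : R * W => p.1 *: p.2) \o kf by [].
apply: DiffDef; first exact: differentiable_comp.
rewrite diff_comp // (diff_bilin (f := GRing.scale : R -> W -> W)) //.
by rewrite diff_pair // !diff_val.
Qed.

Lemma is_diff_sum (R : realType) (V W : normedModType R) k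
    (f df : 'I_k -> V -> W) (x : V) :
  (forall j, is_diff x (f j) (df j)) ->
  is_diff x (fun u => \sum_(j < k) f j u) (fun v => \sum_(j < k) df j v).
Proof.
move=> fP; have sumP (s : seq 'I_k) :
    is_diff x (fun u => \sum_(j <- s) f j u) (fun v => \sum_(j <- s) df j v).
  elim: s => [|j s IHs].
    under eq_fun do rewrite big_nil; under [X in is_diff_def _ _ X]eq_fun do rewrite big_nil.
    exact: is_diff_cst.
  under eq_fun do rewrite big_cons; under [X in is_diff_def _ _ X]eq_fun do rewrite big_cons.
  exact: (is_diffD (fP j) IHs).
exact: sumP.
Qed.

(** * Charts of a Lie group and the adjoint action *)

Section LieGroupCharts.
Variables (R : realType) (n : nat) (G : lieGroupType R n).
Notation V := 'rV[R]_n.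
Implicit Types (a b c : chart R n G) (p q g : G).

Lemma chart_near a p : dom a p ->
  \forall u \near coord a p, dom a (param a u) /\ coord a (param a u) = u.
Proof.
move=> ap; have : nbhs (coord a p) (coord a @` dom a).
  by apply: open_nbhs_nbhs; split; [exact: codom_open|exists p].
by apply: filterS => u [q aq <-]; rewrite (coordK aq).
Qed.

Lemma coord_cvg a p : dom a p -> coord a @ p --> coord a p.
Proof.
move=> ap; have := @coord_continuous _ _ _ a.
by rewrite continuous_open_subspace ?inE; [apply; rewrite inE|exact: dom_open].
Qed.

Lemma param_cvg a p : dom a p -> param a @ coord a p --> p.
Proof.
move=> ap; have := @param_continuous _ _ _ a.
rewrite continuous_open_subspace; last exact: codom_open.
move=> /(_ (coord a p)); rewrite inE /continuous_at coordK //; apply.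
by exists p.
Qed.

Lemma dom_near a p : dom a p -> \forall q \near p, dom a q.
Proof. by move=> ap; apply: open_nbhs_nbhs; split; [exact: dom_open|]. Qed.

Lemma mulg_cvg (T : topologicalType) (x : T) (f h : T -> G) p q :
  f @ x --> p -> h @ x --> q -> (fun y => (f y * h y)%g) @ x --> (p * q)%g.
Proof.
move=> fp hq; have c : (fun z : G * G => (z.1 * z.2)%g) @ (p, q) --> (p * q)%g.
  exact: (@lie_mul_continuous _ _ G (p, q)).
exact: (continuous2_cvg (h := fun x y : G => (x * y)%g) _ c fp hq).
Qed.

Lemma cstg_cvg (T : topologicalType) (x : T) p : (fun=> p) @ x --> p.
Proof. by apply: cvg_cst. Qed.

Lemma invg_cvg (T : topologicalType) (x : T) (f : T -> G) p :
  f @ x --> p -> (fun y => (f y)^-1%g) @ x --> (p^-1)%g.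
Proof.
move=> fp; have c : (fun x : G => (x^-1)%g) @ p --> (p^-1)%g.
  exact: (@lie_inv_continuous _ _ G p).
exact: cvg_comp fp c.
Qed.

Lemma mull_param_cvg a g p : dom a p ->
  (fun u => (g * param a u)%g) @ coord a p --> (g * p)%g.
Proof. by move=> ap; apply: mulg_cvg; [exact: cstg_cvg|exact: param_cvg]. Qed.

Lemma differentiable_mul_coord a b c p q :
  atlas a -> atlas b -> atlas c -> dom a p -> dom b q -> dom c (p * q)%g ->
  differentiable (fun u : V * V => coord c (param a u.1 * param b u.2)%g)
    (coord a p, coord b q).
Proof.
move=> Aa Ab Ac ap bq cpq; have [+ _] := lie_mul_smooth _ _ _ Aa Ab Ac 1%N.
by apply; exists (p, q).
Qed.

(** Translation by [g] is multiplication with one factor frozen, [g] being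
written through a chart [d] around it. *)
Lemma differentiable_mull_coord a b g p :
  atlas a -> atlas b -> dom a p -> dom b (g * p)%g ->
  differentiable (fun u => coord b (g * param a u)%g) (coord a p).
Proof.
move=> Aa Ab ap bgp; have [d Ad dg] := atlas_cover g.
have := differentiable_mul_coord Ad Aa Ab dg ap bgp => dm.
have -> : (fun u => coord b (g * param a u)%g) =
    (fun u : V * V => coord b (param d u.1 * param a u.2)%g) \o
    (fun u => (coord d g, u)) by apply/funext => u /=; rewrite coordK.
by apply: differentiable_comp => //; apply: differentiable_pair.
Qed.

Lemma differentiable_mulr_coord a b g p :
  atlas a -> atlas b -> dom a p -> dom b (p * g)%g ->
  differentiable (fun u => coord b (param a u * g)%g) (coord a p).
Proof.
move=> Aa Ab ap bpg; have [d Ad dg] := atlas_cover g.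
have := differentiable_mul_coord Aa Ad Ab ap dg bpg => dm.
have -> : (fun u => coord b (param a u * g)%g) =
    (fun u : V * V => coord b (param a u.1 * param d u.2)%g) \o
    (fun u => (u, coord d g)) by apply/funext => u /=; rewrite coordK.
by apply: differentiable_comp => //; apply: differentiable_pair.
Qed.

Section Identity.
Variable a : chart R n G.
Hypotheses (Aa : atlas a) (a1 : dom a 1%g).
Notation u0 := (coord a 1%g).

Definition conj_coord g (u : V) : V := coord a (g * param a u * g^-1)%g.

Lemma AdE g X : Ad a g X = 'd (conj_coord g) u0 X.
Proof. by []. Qed.

Lemma conj_coord1 g : conj_coord g u0 = u0.
Proof. by rewrite /conj_coord coordK // mulg1 mulgV. Qed.

Lemma conj_near g : \forall u \near u0, dom a (g * param a u * g^-1)%g.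
Proof.
have : (fun u => (g * param a u * g^-1)%g) @ u0 --> (g * 1 * g^-1)%g.
  apply: mulg_cvg; last exact: cstg_cvg.
  exact: mull_param_cvg.
by apply; rewrite mulg1 mulgV; exact: dom_near.
Qed.

(** Conjugation leaves and re-enters the chart at 1 through a chart [b] around
[g]: it is [v |-> g v] from [a] to [b] followed by [w |-> w g^-1] from [b] to
[a]. *)
Lemma differentiable_conj g : differentiable (conj_coord g) u0.
Proof.
have [b Ab bg] := atlas_cover g.
have bg1 : dom b (g * 1)%g by rewrite mulg1.
have dl := differentiable_mull_coord Aa Ab a1 bg1.
have ag : dom a (g * g^-1)%g by rewrite mulgV.
have dr := differentiable_mulr_coord Ab Aa bg ag.
pose f := (fun u => coord a (param b u * g^-1)%g) \o
  (fun u => coord b (g * param a u)%g).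
have df : differentiable f u0.
  by apply: differentiable_comp => //; rewrite coordK // mulg1.
apply: near_eq_differentiable df.
have bnear : \forall u \near u0, dom b (g * param a u)%g.
  exact: (mull_param_cvg a1 (dom_near bg1)).
apply: filterS bnear => u bgu.
by rewrite /f /= coordK.
Qed.

End Identity.
End LieGroupCharts.

Section AdjointRepresentation.
Variables (R : realType) (n : nat) (G : lieGroupType R n) (a : chart R n G).
Hypotheses (Aa : atlas a) (a1 : dom a 1%g).
Notation V := 'rV[R]_n.
Notation u0 := (coord a 1%g).
Implicit Types (g h : G) (X Y : V).

Lemma Ad1 X : Ad a 1%g X = X.
Proof.
rewrite AdE; have e : {near u0, id =1 conj_coord a 1%g}.
  apply: filterS (chart_near a1) => u [_ uK].
  by rewrite /conj_coord mul1g invg1 mulg1.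
have di : differentiable (@idfun V) u0 by [].
by apply: etrans (esym (near_eq_diff X e di)) _; rewrite diff_val.
Qed.

Lemma AdM g h X : Ad a (g * h)%g X = Ad a g (Ad a h X).
Proof.
have e : {near u0, conj_coord a g \o conj_coord a h =1 conj_coord a (g * h)%g}.
  apply: filterS (conj_near a1 h) => u ahu.
  by rewrite /conj_coord /= coordK // invgM !mulgA.
have dh := differentiable_conj Aa a1 h.
have dg : differentiable (conj_coord a g) (conj_coord a h u0).
  by rewrite conj_coord1 //; exact: differentiable_conj.
have dgh : differentiable (conj_coord a g \o conj_coord a h) u0.
  exact: differentiable_comp.
have dE := esym (near_eq_diff X e dgh).
by apply: etrans dE _; apply: etrans (diff_compE _ dh dg) _; rewrite conj_coord1.
Qed.

(* Multiplication and inversion read in the chart a. *)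
Let m (u : V * V) : V := coord a (param a u.1 * param a u.2)%g.
Let inv (u : V) : V := coord a (param a u)^-1%g.
Let p0 := (u0, u0).

Lemma differentiable_m_near : \forall u \near p0, differentiable m u.
Proof.
have cm : (fun u : V * V => (param a u.1 * param a u.2)%g) @ p0 --> (1 * 1)%g.
  apply: mulg_cvg.
    apply: (@cvg_comp _ _ _ fst (param a) _ (nbhs u0)); first exact: cvg_fst.
    exact: param_cvg.
  apply: (@cvg_comp _ _ _ snd (param a) _ (nbhs u0)); first exact: cvg_snd.
  exact: param_cvg.
have a11 : dom a (1 * 1)%g by rewrite mulg1.
have n12 : \forall u \near p0, dom a (param a u.1 * param a u.2)%g.
  exact: cm _ (dom_near a11).
have n1 : \forall u \near p0, dom a (param a u.1) /\ coord a (param a u.1) = u.1.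
  exact: cvg_fst (chart_near a1).
have n2 : \forall u \near p0, dom a (param a u.2) /\ coord a (param a u.2) = u.2.
  exact: cvg_snd (chart_near a1).
apply: filterS3 n1 n2 n12 => -[u v] /= [au uE] [av vE] auv.
by rewrite -uE -vE; exact: differentiable_mul_coord.
Qed.

Lemma differentiable_derive_m v : differentiable ('D_v m) p0.
Proof.
have [_ /(_ v) [+ _]] := lie_mul_smooth _ _ _ Aa Aa Aa 2.
by apply; exists (1%g, 1%g) => //; split => //=; rewrite mulg1.
Qed.

Lemma m_left : {near u0, (fun u => m (u, u0)) =1 (fun u => u)}.
Proof.
by apply: filterS (chart_near a1) => u [_ uK]; rewrite /m /= coordK // mulg1.
Qed.

Lemma m_right : {near u0, (fun u => m (u0, u)) =1 (fun u => u)}.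
Proof.
by apply: filterS (chart_near a1) => u [_ uK]; rewrite /m /= coordK // mul1g.
Qed.

Lemma differentiable_m_left : \forall u \near u0, differentiable m (u, u0).
Proof.
apply: filterS (chart_near a1) => u [au uK]; rewrite -uK.
by apply: differentiable_mul_coord => //; rewrite mulg1.
Qed.

Lemma differentiable_m : differentiable m p0.
Proof. exact: nbhs_singleton differentiable_m_near. Qed.

Lemma diff_m_left w : \forall u \near u0, 'd m (u, u0) (w, 0) = w.
Proof.
apply: filterS2 differentiable_m_left (near_join m_left) => u dm eu.
have [_ dE] := diff_slice_left_id w dm.
apply: etrans (esym dE) _.
exact: diff_eq_id.
Qed.

Lemma diff_m_right w : 'd m p0 (0, w) = w.
Proof.
have [_ dE] := diff_slice_right_id w differentiable_m.
apply: etrans (esym dE) _.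
exact: diff_eq_id m_right.
Qed.

Lemma diff_m X Y : 'd m p0 (X, Y) = X + Y.
Proof.
have -> : (X, Y) = (X, 0) + (0, Y) :> V * V by congr pair => /=; rewrite ?addr0 ?add0r.
by rewrite linearD diff_m_right (nbhs_singleton (diff_m_left X)).
Qed.

Lemma inv_coord1 : inv u0 = u0.
Proof. by rewrite /inv coordK // invg1. Qed.

Lemma differentiable_inv : differentiable inv u0.
Proof.
have [+ _] := lie_inv_smooth _ _ Aa Aa 1.
by apply; exists 1%g => //=; rewrite invg1.
Qed.

Lemma dom_inv_near : \forall u \near u0, dom a (param a u)^-1%g.
Proof.
have := invg_cvg (param_cvg a1); rewrite invg1 => c.
exact: c _ (dom_near a1).
Qed.

(** Differentiate [u * u^-1 = 1]. *)
Lemma diff_inv X : 'd inv u0 X = - X.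
Proof.
have e : {near u0, (fun u => m (u, inv u)) =1 (fun=> u0)}.
  by apply: filterS dom_inv_near => u au; rewrite /m /inv /= coordK // mulgV.
have dm : differentiable m (u0, inv u0).
  by rewrite inv_coord1; exact: differentiable_m.
have [ds dE] := diff_slice_id X differentiable_inv dm.
have := etrans (etrans (esym dE) (near_eq_diff X e ds)) (diff_cstE _ _ _).
by rewrite inv_coord1 diff_m => /eqP; rewrite addrC addr_eq0 => /eqP.
Qed.

Lemma differentiable_left_mul g : dom a g ->
  differentiable (fun v => coord a (g * param a v)%g) u0.
Proof. by move=> ag; apply: differentiable_mull_coord => //; rewrite mulg1. Qed.

Lemma left_invariant_fieldE X :
  {near u0, (fun u => 'D_(0, X) m (u, u0)) =1 left_invariant_field a X}.
Proof.
apply: filterS2 (chart_near a1) differentiable_m_left => u [au uK] dm.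
have dm1 : differentiable m (u, u0) by [].
have [_ dE] := diff_slice_right_id X dm1.
by apply: etrans (deriveE (0, X) dm1) _; apply: etrans (esym dE) _.
Qed.

Lemma diff_left_invariant_field X Y :
  differentiable (left_invariant_field a Y) u0 /\
  'd (left_invariant_field a Y) u0 X = 'D_(X, 0) ('D_(0, Y) m) p0.
Proof.
have dD := differentiable_derive_m (0, Y).
have [ds dE] := diff_slice_left_id X dD.
have e := left_invariant_fieldE Y.
split; first exact: near_eq_differentiable ds.
apply: etrans (esym (near_eq_diff X e ds)) _.
by apply: etrans dE (esym (deriveE _ dD)).
Qed.

Lemma left_invariant_field1 X : left_invariant_field a X u0 = X.
Proof.
apply: etrans (esym (nbhs_singleton (left_invariant_fieldE X))) _.
exact: etrans (deriveE _ differentiable_m) (diff_m_right X).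
Qed.

(** The bracket is the antisymmetric part of the mixed second derivative of the
multiplication. *)
Lemma lie_bracketE X Y : lie_bracket a X Y =
  'D_(X, 0) ('D_(0, Y) m) p0 - 'D_(Y, 0) ('D_(0, X) m) p0.
Proof.
rewrite /lie_bracket /field_bracket !left_invariant_field1.
have [dX dXE] := diff_left_invariant_field Y X.
have [dY dYE] := diff_left_invariant_field X Y.
by congr (_ - _); [rewrite -dYE|rewrite -dXE]; apply: deriveE.
Qed.

Definition Ad_coord Y (u : V) : V := Ad a (param a u) Y.

(** Conjugation by the point with coordinates [u] is
[v |-> m (m (u, v), inv u)]. *)
Lemma Ad_coordE Y : \forall u \near u0,
  Ad_coord Y u = 'd m (u, inv u) (left_invariant_field a Y u, 0).
Proof.
apply: filterS2 (chart_near a1) dom_inv_near => u [au uK] aiu.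
set p := param a u in au uK aiu *.
have dl : differentiable (fun v => coord a (p * param a v)%g) u0.
  exact: differentiable_left_mul.
have pu : coord a (p * param a u0)%g = u by rewrite coordK // mulg1.
have dm : differentiable m (coord a (p * param a u0)%g, inv u).
  have -> : (coord a (p * param a u0)%g, inv u) = (coord a p, coord a p^-1%g).
    by rewrite pu uK.
  by apply: differentiable_mul_coord => //; rewrite mulgV.
have [ds dE] := diff_slice_left Y dl dm; rewrite pu in dE.
rewrite /Ad_coord AdE; apply: etrans dE; apply/esym/near_eq_diff => //.
have ap1 : dom a (p * 1)%g by rewrite mulg1.
have bnear : \forall v \near u0, dom a (p * param a v)%g.
  exact: (mull_param_cvg a1 (dom_near ap1)).
apply: filterS bnear => v apv.
by rewrite /m /inv /conj_coord /= !coordK.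
Qed.

Lemma linear_slice_expand (W : normedModType R) (f : {linear (V * V)%type -> W}) w :
  f (w, 0) = \sum_(j < n) w 0 j *: f (delta_mx 0 j, 0).
Proof.
have -> : (w, 0) = \sum_(j < n) w 0 j *: (delta_mx 0 j, 0) :> V * V.
  have sumE (s : seq 'I_n) : \sum_(j <- s) w 0 j *: (delta_mx 0 j, 0) =
      (\sum_(j <- s) w 0 j *: delta_mx 0 j, 0) :> V * V.
    elim: s => [|j s IHs]; first by rewrite !big_nil.
    rewrite !big_cons IHs; congr pair => //=.
    by rewrite scaler0 addr0.
  by rewrite sumE -row_sum_delta.
by rewrite linear_sum; apply: eq_bigr => j _; rewrite linearZ.
Qed.

(** Expanding in the standard basis turns [Ad_coordE] into a sum of products of
differentiable functions, to which the product rule applies. *)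
Lemma Ad_coord_sum Y : {near u0, (fun u =>
    \sum_(j < n) left_invariant_field a Y u 0 j *:
      'D_(delta_mx 0 j, 0) m (u, inv u)) =1 Ad_coord Y}.
Proof.
have n1 : \forall u \near u0, differentiable m (u, inv u).
  apply: filterS2 (chart_near a1) dom_inv_near => u [au uK] aiu.
  have -> : (u, inv u) = (coord a (param a u), coord a (param a u)^-1%g).
    by rewrite uK.
  by apply: differentiable_mul_coord => //; rewrite mulgV.
apply: filterS2 n1 (Ad_coordE Y) => u dm ->; rewrite linear_slice_expand.
by apply: eq_bigr => j _; congr (_ *: _); apply: deriveE.
Qed.

Lemma derive_m_left_left X Y : 'D_(X, 0) ('D_(Y, 0) m) p0 = 0.
Proof.
have dD := differentiable_derive_m (Y, 0).
have [ds dE] := diff_slice_left_id X dD.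
apply: etrans (deriveE _ dD) _; apply: etrans (esym dE) _.
have e : {near u0, (fun u => 'D_(Y, 0) m (u, u0)) =1 (fun=> Y)}.
  apply: filterS2 differentiable_m_left (diff_m_left Y) => u dm dmY.
  exact: etrans (deriveE _ dm) dmY.
by apply: etrans (near_eq_diff X e ds) _; rewrite diff_cstE.
Qed.

(** The adjoint representation of the Lie algebra is the differential of [Ad].
In the product rule for [Ad_coord_sum], the terms differentiating the
left-invariant field give [D_(X,0) D_(0,Y) m].  The others give
[D_(X,-X) D_(Y,0) m = - D_(0,X) D_(Y,0) m], because [m (u, u0) = u] is affine
in [u]; symmetry of second derivatives identifies this with
[- D_(Y,0) D_(0,X) m], the second half of [lie_bracketE]. *)
Lemma diff_Ad_coord X Y :
  differentiable (Ad_coord Y) u0 /\ 'd (Ad_coord Y) u0 X = lie_bracket a X Y.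
Proof.
have [dl dlE] := diff_left_invariant_field X Y.
pose k j (u : V) : R := left_invariant_field a Y u 0 j.
pose f j (u : V) := 'D_(delta_mx 0 j, 0) m (u, inv u).
have dD j := differentiable_derive_m (delta_mx 0 j, 0).
have dDi j : differentiable ('D_(delta_mx 0 j, 0) m) (u0, inv u0).
  by rewrite inv_coord1.
have df j : differentiable (f j) u0.
  by have [] := diff_slice_id X differentiable_inv (dDi j).
have dfE j : 'd (f j) u0 X = - 'D_(delta_mx 0 j, 0) ('D_(0, X) m) p0.
  have [_ dE] := diff_slice_id X differentiable_inv (dDi j).
  apply: etrans dE _; rewrite diff_inv inv_coord1.
  have -> : (X, - X) = (X, 0) - (0, X) :> V * V.
    by congr pair => /=; rewrite ?subr0 ?sub0r.
  apply: etrans (linearB _ _ _) _; rewrite -[RHS]sub0r.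
  congr (_ - _).
    by apply: etrans (esym (deriveE _ (dD j))) _; exact: derive_m_left_left.
  apply: etrans (esym (deriveE _ (dD j))) _.
  exact: derive_sym_rV differentiable_m_near (dD j) (differentiable_derive_m _).
have dk j : differentiable (k j) u0 by exact: differentiable_entry.
have dkE j : 'd (k j) u0 X = ('D_(X, 0) ('D_(0, Y) m) p0) 0 j.
  rewrite -dlE; apply: etrans (esym (deriveE X (dk j))) _.
  by rewrite -deriveE //; apply: esym; apply: derive_entry.
have dkf j : is_diff u0 (fun u => k j u *: f j u)
    (fun v => k j u0 *: 'd (f j) u0 v + 'd (k j) u0 v *: f j u0).
  by apply: is_diff_scale; apply: differentiableP.
have dsum : is_diff u0 (fun u => \sum_(j < n) k j u *: f j u)
    (fun v => \sum_(j < n) (k j u0 *: 'd (f j) u0 v + 'd (k j) u0 v *: f j u0)).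
  exact: is_diff_sum dkf.
have e := Ad_coord_sum Y.
have ds : differentiable (fun u => \sum_(j < n) k j u *: f j u) u0 by exact: ex_diff.
split; first exact: near_eq_differentiable e ds.
apply: etrans (esym (near_eq_diff X e ds)) _; rewrite (@diff_val _ _ _ _ _ _ _ dsum).
rewrite big_split /= lie_bracketE addrC; congr (_ + _).
  under eq_bigr do rewrite dkE /f inv_coord1.
  transitivity ('d m p0 ('D_(X, 0) ('D_(0, Y) m) p0, 0)).
    rewrite linear_slice_expand; apply: eq_bigr => j _; congr (_ *: _).
    exact: deriveE differentiable_m.
  exact: nbhs_singleton (diff_m_left _).
under eq_bigr do rewrite dfE scalerN /k left_invariant_field1.
rewrite sumrN; congr (- _).
have dDX := differentiable_derive_m (0, X).
apply: etrans (esym (deriveE _ dDX)).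
rewrite linear_slice_expand; apply: eq_bigr => j _; congr (_ *: _).
exact: deriveE dDX.
Qed.

End AdjointRepresentation.

Section AdjointLieAlgebra.
Variables (R : realType) (n : nat) (G : lieGroupType R n) (a : chart R n G).
Hypotheses (Aa : atlas a) (a1 : dom a 1%g).
Notation V := 'rV[R]_n.
Notation u0 := (coord a 1%g).
Notation br := (lie_bracket a).
Implicit Types (g h : G) (X Y Z : V).

Lemma Ad_coord1 Y : Ad_coord a Y u0 = Y.
Proof. by rewrite /Ad_coord coordK // Ad1. Qed.

Lemma lie_bracketN X Y : br X Y = - br Y X.
Proof. by rewrite /lie_bracket /field_bracket opprB. Qed.

Lemma lie_bracket_diff X Y : br X Y = 'd (Ad_coord a Y) u0 X.
Proof. by have [_ ->] := diff_Ad_coord Aa a1 X Y. Qed.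

Lemma lie_bracket_linearl k X Z Y : br (k *: X + Z) Y = k *: br X Y + br Z Y.
Proof.
rewrite (lie_bracket_diff (k *: X + Z)) (lie_bracket_diff X) (lie_bracket_diff Z).
exact: linearP.
Qed.

Lemma lie_bracket_linearr k X Z Y : br Y (k *: X + Z) = k *: br Y X + br Y Z.
Proof.
rewrite (lie_bracketN Y) (lie_bracketN Y X) (lie_bracketN Y Z).
by rewrite lie_bracket_linearl opprD scalerN.
Qed.

(** Differentiate [Ad g (Ad u Y) = Ad (g u g^-1) (Ad g Y)] at [u = 1]. *)
Lemma Ad_lie_bracket g X Y : Ad a g (br X Y) = br (Ad a g X) (Ad a g Y).
Proof.
have [dY dYE] := diff_Ad_coord Aa a1 X Y.
have [dgY dgYE] := diff_Ad_coord Aa a1 (Ad a g X) (Ad a g Y).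
have dc := differentiable_conj Aa a1 g.
pose L := 'd (conj_coord a g) u0.
have Lc : continuous L by exact: diff_continuous.
have [dl dlE] := diff_linear_comp X Lc dY.
have dgYc : differentiable (Ad_coord a (Ad a g Y)) (conj_coord a g u0).
  by rewrite conj_coord1.
have e : {near u0, L \o Ad_coord a Y =1 Ad_coord a (Ad a g Y) \o conj_coord a g}.
  apply: filterS (conj_near a1 g) => u au.
  have -> : (L \o Ad_coord a Y) u = Ad a g (Ad a (param a u) Y) by [].
  have -> : (Ad_coord a (Ad a g Y) \o conj_coord a g) u =
      Ad a (g * param a u * g^-1)%g (Ad a g Y).
    by rewrite /= /Ad_coord /conj_coord (coordK au).
  rewrite -(AdM Aa a1 g (param a u) Y) -(AdM Aa a1 _ g Y).
  by rewrite -!mulgA mulVg mulg1.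
have lE : 'd (L \o Ad_coord a Y) u0 X = Ad a g (br X Y).
  exact: etrans dlE (congr1 L dYE).
have rE : 'd (Ad_coord a (Ad a g Y) \o conj_coord a g) u0 X =
    br (Ad a g X) (Ad a g Y).
  apply: etrans (diff_compE X dc dgYc) _.
  by rewrite conj_coord1.
exact: etrans (esym lE) (etrans (near_eq_diff X e dl) rE).
Qed.

(** Near [g] one has [Ad h = Ad g (Ad (g^-1 h))], which reduces continuity to
the point 1. *)
Lemma Ad_continuous Y : continuous (fun g : G => Ad a g Y).
Proof.
move=> g; have [dY _] := diff_Ad_coord Aa a1 0 Y.
have c1 : (fun h : G => (g^-1 * h)%g) @ g --> 1%g.
  rewrite -(mulVg g); apply: mulg_cvg; first exact: cstg_cvg.
  exact: cvg_id.
have c2 : (fun h : G => coord a (g^-1 * h)%g) @ g --> u0.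
  exact: cvg_comp c1 (coord_cvg a1).
have c3 : (fun h : G => Ad_coord a Y (coord a (g^-1 * h)%g)) @ g --> Y.
  rewrite -[Y in _ --> Y]Ad_coord1.
  exact: cvg_comp c2 (differentiable_continuous dY).
have Lc : continuous ('d (conj_coord a g) u0).
  by apply: diff_continuous; exact: differentiable_conj.
have c4 : (fun h : G => Ad a g (Ad_coord a Y (coord a (g^-1 * h)%g))) @ g --> Ad a g Y.
  exact: cvg_comp c3 (Lc Y).
apply: cvg_trans c4; apply: near_eq_cvg.
have ng : \forall h \near g, dom a (g^-1 * h)%g by exact: c1 _ (dom_near a1).
apply: filterS ng => h ah.
have -> : Ad_coord a Y (coord a (g^-1 * h)%g) = Ad a (g^-1 * h)%g Y.
  by rewrite /Ad_coord (coordK ah).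
by rewrite -(AdM Aa a1 g (g^-1 * h)%g Y) mulgA mulgV mul1g.
Qed.

Lemma Ad_param_derivative X Y :
  (fun t : R => t^-1 *: (Ad a (param a (t *: X + u0)) Y - Y)) @ 0^' --> br X Y.
Proof.
have [dY dYE] := diff_Ad_coord Aa a1 X Y.
have := @diff_derivable _ _ _ _ _ X dY.
rewrite /derivable -/(derive _ _ _) deriveE // dYE /= Ad_coord1.
by [].
Qed.

End AdjointLieAlgebra.

(** * Bilinear forms and traces *)

Section Forms.
Variables (R : realType) (n : nat).
Notation V := 'rV[R]_n.
Implicit Types (S A T B : 'M[R]_n) (x y z v w : V).

Definition form S x y : R := (x *m S *m y^T) 0 0.

Lemma form_linearl S k x z y : form S (k *: x + z) y = k * form S x y + form S z y.
Proof. by rewrite /form !mulmxDl -!scalemxAl !mxE. Qed.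

Lemma form_linearr S k x z y : form S y (k *: x + z) = k * form S y x + form S y z.
Proof. by rewrite /form linearD linearZ mulmxDr -scalemxAr !mxE. Qed.

Lemma form0l S y : form S 0 y = 0.
Proof. by rewrite /form !mul0mx mxE. Qed.

Lemma form0r S y : form S y 0 = 0.
Proof. by rewrite /form trmx0 mulmx0 mxE. Qed.

Lemma formDl S x z y : form S (x + z) y = form S x y + form S z y.
Proof. by rewrite -[x]scale1r form_linearl mul1r scale1r. Qed.

Lemma formDr S x z y : form S y (x + z) = form S y x + form S y z.
Proof. by rewrite -[x]scale1r form_linearr mul1r scale1r. Qed.

Lemma formZl S k x y : form S (k *: x) y = k * form S x y.
Proof. by rewrite -[k *: x]addr0 form_linearl form0l addr0. Qed.

Lemma formZr S k x y : form S y (k *: x) = k * form S y x.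
Proof. by rewrite -[k *: x]addr0 form_linearr form0r addr0. Qed.

Lemma formNl S x y : form S (- x) y = - form S x y.
Proof. by rewrite -scaleN1r formZl mulN1r. Qed.

Lemma formNr S x y : form S y (- x) = - form S y x.
Proof. by rewrite -scaleN1r formZr mulN1r. Qed.

Lemma form_mull S A x y : form S (x *m A) y = form (A *m S) x y.
Proof. by rewrite /form !mulmxA. Qed.

Lemma form_mulr S A x y : form S x (y *m A) = form (S *m A^T) x y.
Proof. by rewrite /form trmx_mul !mulmxA. Qed.

Lemma form_tr S x y : form S^T x y = form S y x.
Proof.
rewrite /form; have -> : x *m S^T *m y^T = (y *m S *m x^T)^T.
  by rewrite !trmx_mul trmxK mulmxA.
by rewrite [LHS]mxE.
Qed.

Lemma form_delta S i j : form S (delta_mx 0 i) (delta_mx 0 j) = S i j.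
Proof. by rewrite /form -rowE trmx_delta -colE !mxE. Qed.

Lemma form_rows S A B i j : form S (row i A) (row j B) = (A *m S *m B^T) i j.
Proof. by rewrite -form_delta -mulmxA -form_mull -form_mulr -!rowE. Qed.

Lemma form_inj S T : form S =2 form T -> S = T.
Proof. by move=> ST; apply/matrixP => i j; rewrite -!form_delta ST. Qed.

Definition posdef S := S^T = S /\ forall x, x != 0 -> 0 < form S x x.

Section PositiveDefinite.
Variable S : 'M[R]_n.
Hypothesis pS : posdef S.

Lemma form_sym x y : form S x y = form S y x.
Proof. by have [SE _] := pS; rewrite -form_tr SE. Qed.

Lemma form_ge0 x : 0 <= form S x x.
Proof.
by have [_ S0] := pS; have [->|/S0/ltW//] := eqVneq x 0; rewrite form0l.
Qed.

Lemma form_eq0 x : form S x x <= 0 -> x = 0.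
Proof.
by have [_ S0] := pS; apply: contraTeq => /S0; rewrite ltNge.
Qed.

Lemma form_nondegenerate x : (forall y, form S x y = 0) -> x = 0.
Proof. by move=> x0; apply: form_eq0; rewrite x0. Qed.

(** Gram-Schmidt: as long as [k < n], some nonzero vector is orthogonal to the
family, and it can be normalised. *)
Lemma orthonormal_family k : (k <= n)%N ->
  exists U : 'M[R]_(k, n), U *m S *m U^T = 1%:M.
Proof.
elim: k => [_|k IHk kn]; first by exists 0; rewrite [LHS]flatmx0 [RHS]flatmx0.
have [U UE] := IHk (ltnW kn).
have : kermx (S *m U^T) != 0.
  rewrite -mxrank_eq0 mxrank_ker subn_eq0 -ltnNge.
  by rewrite (leq_ltn_trans (rank_leq_col _)).
move=> /rowV0Pn[x /sub_kermxP xU x0].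
have [_ /(_ _ x0) xx] := pS.
pose y := (Num.sqrt (form S x x))^-1 *: x.
have yU : y *m S *m U^T = 0 by rewrite -mulmxA -scalemxAl xU scaler0.
have Uy : U *m S *m y^T = 0.
  apply: trmx_inj; rewrite trmx0 -yU !trmx_mul trmxK mulmxA.
  by have [-> _] := pS.
have yy : y *m S *m y^T = 1%:M.
  apply/rowP => i; rewrite !ord1 -[LHS]/(form S y y) formZl formZr mxE eqxx.
  rewrite mulrA -invfM -expr2 sqr_sqrtr ?mulVf // ?gt_eqF //; exact: ltW.
rewrite -[k.+1]/(1 + k)%N; exists (col_mx y U).
by rewrite mul_col_mx tr_col_mx mul_col_row yy yU Uy UE -scalar_mx_block.
Qed.

Lemma orthonormal_basis : exists P : 'M[R]_n, P *m S *m P^T = 1%:M.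
Proof. exact: orthonormal_family (leqnn n). Qed.

Lemma mxtrace_form (P T : 'M[R]_n) : P *m S *m P^T = 1%:M ->
  \tr T = \sum_i form S (row i P *m T) (row i P).
Proof.
move=> PE; have PE' : (S *m P^T) *m P = 1%:M by apply: mulmx1C; rewrite mulmxA.
rewrite -[T in LHS]mulmx1 -PE' mulmxA mxtrace_mulC !mulmxA.
by apply: eq_bigr => i _; rewrite -row_mul form_rows.
Qed.

(** In an orthonormal basis the trace is the sum of the values [form S (v T) v]
at the basis vectors. *)
Lemma mxtrace_ge0 T : (forall v, 0 <= form S (v *m T) v) -> 0 <= \tr T.
Proof.
move=> T0; have [P PE] := orthonormal_basis.
by rewrite (mxtrace_form T PE); apply: sumr_ge0 => i _; exact: T0.
Qed.

(** For a skew [B], the trace of [B *m B] is minus the sum of the squared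
lengths of the images of an orthonormal basis. *)
Lemma skew_mxtrace_sqr B :
  (forall v w, form S (v *m B) w = - form S v (w *m B)) ->
  \tr (B *m B) <= 0 /\ (\tr (B *m B) = 0 -> B = 0).
Proof.
move=> skewB; have [P PE] := orthonormal_basis.
have trE : - \tr (B *m B) = \sum_i form S (row i P *m B) (row i P *m B).
  rewrite (mxtrace_form _ PE) -sumrN; apply: eq_bigr => i _.
  by rewrite mulmxA skewB opprK.
split; first by rewrite -oppr_ge0 trE sumr_ge0 // => i _; exact: form_ge0.
move=> tr0; move: trE; rewrite tr0 oppr0 => /esym/eqP.
rewrite psumr_eq0 => [/allP PB0|i _]; last exact: form_ge0.
have PB : P *m B = 0.
  apply/row_matrixP => i; rewrite row_mul row0; apply: form_eq0.
  by have /(_ (mem_index_enum i))/eqP -> := PB0 i.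
have PE' : (S *m P^T) *m P = 1%:M by apply: mulmx1C; rewrite mulmxA.
by rewrite -[B]mul1mx -PE' -mulmxA PB mulmx0.
Qed.

(** The normal equations: the Gram matrix [M] of a free family is invertible
because the form is definite. *)
Lemma orthogonal_projection k (E : 'M[R]_(k, n)) : row_free E ->
  exists Q : 'M[R]_(n, k), forall x (w : 'rV_k),
    form S (x - x *m Q *m E) (w *m E) = 0.
Proof.
move=> fE; pose M := E *m S *m E^T.
have uM : M \in unitmx.
  rewrite -row_free_unit -kermx_eq0; apply/rowV0P => w /sub_kermxP wM.
  apply: (row_free_inj fE); rewrite mul0mx.
  apply: form_eq0; suff -> : form S (w *m E) (w *m E) = 0 by [].
  by rewrite /form trmx_mul -!mulmxA (mulmxA E) (mulmxA _ _ w^T) mulmxA -/M wM mul0mx mxE.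
exists (S *m E^T *m invmx M) => x w.
have xE : (x - x *m (S *m E^T *m invmx M) *m E) *m S *m E^T = 0.
  by rewrite !mulmxBl -!mulmxA (mulmxA E) -/M mulVmx // mulmx1 subrr.
by rewrite /form trmx_mul (mulmxA _ E^T) xE mul0mx mxE.
Qed.

End PositiveDefinite.
End Forms.

(** * Limits of matrices *)

Section MatrixTopology.
Variable R : realType.

Lemma mx_norm_entry p q (A : 'M[R]_(p, q)) i j : `|A i j| <= `|A|.
Proof. by rewrite [leRHS]/Num.Def.normr/= mx_normrE; exact: (le_bigmax _ _ (i, j)). Qed.

Lemma mx_norm_le p q (A : 'M[R]_(p, q)) e : 0 <= e ->
  (forall i j, `|A i j| <= e) -> `|A| <= e.
Proof.
move=> e0 Ae; rewrite /Num.Def.normr/= mx_normrE.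
by apply: bigmax_le => // -[i j] _; exact: Ae.
Qed.

Lemma mulmx_norm_le p q r (A : 'M[R]_(p, q)) (B : 'M[R]_(q, r)) :
  `|A *m B| <= q%:R * (`|A| * `|B|).
Proof.
apply: mx_norm_le => [|i j]; first by rewrite !mulr_ge0.
rewrite mxE (le_trans (ler_norm_sum _ _ _)) //.
have -> : q%:R * (`|A| * `|B|) = \sum_(k < q) `|A| * `|B|.
  by rewrite sumr_const card_ord mulr_natl.
apply: ler_sum => k _.
by rewrite normrM ler_pM // mx_norm_entry.
Qed.

Lemma trmx_norm_le p q (A : 'M[R]_(p, q)) : `|A^T| <= `|A|.
Proof. by apply: mx_norm_le => // i j; rewrite mxE mx_norm_entry. Qed.

Section Limits.
Context {T : Type} {F : set_system T} {FF : Filter F}.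

Lemma cvg_mx p q (M : T -> 'M[R]_(p, q)) (L : 'M[R]_(p, q)) :
  (forall i j, (fun t => M t i j) @ F --> L i j) -> M @ F --> L.
Proof.
move=> ML; apply/cvgrPdist_le => /= e e0; near=> t.
apply: mx_norm_le => [|i j]; first exact: ltW.
rewrite !mxE; move: i j; near: t; apply: filter_forall => i.
by apply: filter_forall => j; apply: (cvgrPdist_le _ _).1 (ML i j) e e0.
Unshelve. all: by end_near. Qed.

Lemma cvg_entry p q (M : T -> 'M[R]_(p, q)) (L : 'M[R]_(p, q)) i j :
  M @ F --> L -> (fun t => M t i j) @ F --> L i j.
Proof. by move=> ML; exact: cvg_comp ML (@matrix_normedtype.coord_continuous R p q i j L). Qed.

Lemma cvgr_sum_ord k (f : 'I_k -> T -> R) (l : 'I_k -> R) :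
  (forall i, f i @ F --> l i) -> (fun t => \sum_i f i t) @ F --> \sum_i l i.
Proof.
move=> fl; have sl (s : seq 'I_k) :
    (fun t => \sum_(i <- s) f i t) @ F --> \sum_(i <- s) l i.
  elim: s => [|i s IHs].
    by under eq_fun do rewrite big_nil; rewrite big_nil; exact: cvg_cst.
  under eq_fun do rewrite big_cons; rewrite big_cons.
  exact: cvgD (fl i) IHs.
exact: sl.
Qed.

Lemma cvg_mulmx p q r (M : T -> 'M[R]_(p, q)) (N : T -> 'M[R]_(q, r))
    (L : 'M[R]_(p, q)) (K : 'M[R]_(q, r)) :
  M @ F --> L -> N @ F --> K -> (fun t => M t *m N t) @ F --> L *m K.
Proof.
move=> ML NK; apply: cvg_mx => i j; rewrite mxE; under eq_fun do rewrite mxE.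
by apply: cvgr_sum_ord => k; apply: cvgM; exact: cvg_entry.
Qed.

Lemma cvg_trmx p q (M : T -> 'M[R]_(p, q)) (L : 'M[R]_(p, q)) :
  M @ F --> L -> (fun t => (M t)^T) @ F --> L^T.
Proof.
move=> ML; apply: cvg_mx => i j; rewrite mxE; under eq_fun do rewrite mxE.
exact: cvg_entry.
Qed.

Lemma cvg_form n (S : 'M[R]_n) (x y : T -> 'rV[R]_n) (a b : 'rV[R]_n) :
  x @ F --> a -> y @ F --> b -> (fun t => form S (x t) (y t)) @ F --> form S a b.
Proof.
move=> xa yb; apply: cvg_entry; apply: cvg_mulmx (cvg_trmx yb).
by apply: cvg_mulmx xa _; exact: cvg_cst.
Qed.

End Limits.
End MatrixTopology.

(** * Bounded matrix groups preserve an inner product *)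

Section Frobenius.
Variable R : realType.

(** The square of the Frobenius norm; unlike the library norm (the largest
entry) it is strictly convex. *)
Definition fro2 p q (A : 'M[R]_(p, q)) : R := \sum_i \sum_j A i j ^+ 2.

Lemma fro2_ge0 p q (A : 'M[R]_(p, q)) : 0 <= fro2 A.
Proof. by apply: sumr_ge0 => i _; apply: sumr_ge0 => j _; exact: sqr_ge0. Qed.

Lemma entry_fro2 p q (A : 'M[R]_(p, q)) i j : A i j ^+ 2 <= fro2 A.
Proof.
rewrite /fro2 (bigD1 i) //= (bigD1 j) //= -addrA lerDl addr_ge0 //.
  by apply: sumr_ge0 => k _; exact: sqr_ge0.
by apply: sumr_ge0 => k _; apply: sumr_ge0 => l _; exact: sqr_ge0.
Qed.

Lemma norm_fro2 p q (A : 'M[R]_(p, q)) : `|A| ^+ 2 <= fro2 A.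
Proof.
rewrite -[leRHS]sqr_sqrtr ?fro2_ge0 // ler_sqr ?nnegrE ?sqrtr_ge0 //.
apply: mx_norm_le => [|i j]; first exact: sqrtr_ge0.
by rewrite -sqrtr_sqr ler_wsqrtr // entry_fro2.
Qed.

Lemma fro2_eq0 p q (A : 'M[R]_(p, q)) : fro2 A = 0 -> A = 0.
Proof.
move=> A0; apply/eqP; rewrite -normr_eq0 -sqrf_eq0 eq_le sqr_ge0 andbT.
by rewrite -A0 norm_fro2.
Qed.

Lemma fro2_le_norm p q (A : 'M[R]_(p, q)) : fro2 A <= (p * q)%:R * `|A| ^+ 2.
Proof.
have -> : (p * q)%:R * `|A| ^+ 2 = \sum_(i < p) \sum_(j < q) `|A| ^+ 2.
  by rewrite !sumr_const !card_ord -mulrnA mulnC mulr_natl.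
apply: ler_sum => i _; apply: ler_sum => j _.
by rewrite -real_normK ?num_real // ler_sqr ?nnegrE // mx_norm_entry.
Qed.

Lemma fro2_form n (v : 'rV[R]_n) : fro2 v = form 1%:M v v.
Proof.
rewrite /fro2 big_ord1 /form mulmx1 mxE; apply: eq_bigr => j _.
by rewrite mxE expr2.
Qed.

Lemma fro2_tr p q (A : 'M[R]_(p, q)) : fro2 A^T = fro2 A.
Proof.
rewrite /fro2 exchange_big; apply: eq_bigr => i _; apply: eq_bigr => j _.
by rewrite mxE.
Qed.

Lemma fro2_midpoint p q (A B : 'M[R]_(p, q)) :
  fro2 (2^-1 *: (A + B)) = (fro2 A + fro2 B) / 2 - fro2 (A - B) / 4.
Proof.
rewrite /fro2 -big_split /= !mulr_suml -sumrB; apply: eq_bigr => i _.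
rewrite -big_split /= !mulr_suml -sumrB; apply: eq_bigr => j _.
by rewrite !mxE; field.
Qed.

Lemma cvg_fro2 {T : Type} {F : set_system T} {FF : Filter F} p q
    (M : T -> 'M[R]_(p, q)) (L : 'M[R]_(p, q)) :
  M @ F --> L -> (fun t => fro2 (M t)) @ F --> fro2 L.
Proof.
move=> ML; do 2![apply: cvgr_sum_ord => ?].
rewrite expr2; under eq_fun do rewrite expr2.
by apply: cvgM; exact: cvg_entry.
Qed.

End Frobenius.

Section InvariantForm.
Variables (R : realType) (n : nat) (Gam : set 'M[R]_n).
Hypothesis Gam1 : Gam 1%:M.
Hypothesis GamM : forall M N, Gam M -> Gam N -> Gam (M *m N).
Hypothesis GamV : forall M, Gam M -> exists2 N, Gam N & N *m M = 1%:M.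
Variable c : R.
Hypothesis Gam_bounded : forall M, Gam M -> `|M| <= c.

(** The orbit of [S] stays above the standard inner product, so that limits
remain definite, and inside the Frobenius ball of squared radius [r]. *)
Definition admissible (r : R) (S : 'M[R]_n) := forall M, Gam M ->
  (forall v, fro2 v <= form S (v *m M) (v *m M)) /\ fro2 (M *m S *m M^T) <= r.

Let c_ge0 : 0 <= c. Proof. exact: le_trans (Gam_bounded Gam1). Qed.

Lemma admissible_act r S M : Gam M -> admissible r S -> admissible r (M *m S *m M^T).
Proof.
move=> GM AS N GN; have [AS1 AS2] := AS _ (GamM GN GM); split.
  move=> v; rewrite (le_trans (AS1 v)) // le_eqVlt; apply/orP; left; apply/eqP.
  by rewrite mulmxA form_mull form_mulr.
by move: AS2; rewrite trmx_mul !mulmxA.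
Qed.

Lemma admissible_tr r S : admissible r S -> admissible r S^T.
Proof.
move=> AS M GM; have [AS1 AS2] := AS M GM; split=> [v|]; first by rewrite form_tr.
by rewrite -fro2_tr !trmx_mul !trmxK mulmxA.
Qed.

Lemma congr_norm_le (A B S : 'M[R]_n) : `|A| <= c -> `|B| <= c ->
  `|A *m S *m B| <= (n%:R * c) ^+ 2 * `|S|.
Proof.
move=> Ac Bc; have n0 : 0 <= n%:R :> R by [].
have -> : (n%:R * c) ^+ 2 * `|S| = n%:R * ((n%:R * (c * `|S|)) * c) by ring.
apply: le_trans (mulmx_norm_le _ _) _; rewrite ler_wpM2l // ler_pM //.
by apply: le_trans (mulmx_norm_le _ _) _; rewrite ler_wpM2l // ler_pM.
Qed.

Lemma Gam_inv M : Gam M -> exists N, [/\ Gam N, N *m M = 1%:M & M *m N = 1%:M].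
Proof. by move=> /GamV[N GN NM]; exists N; split => //; exact: mulmx1C. Qed.

Lemma admissible_ex : exists r S, admissible r S.
Proof.
pose k := n%:R * (n%:R * c) ^+ 2.
have k0 : 0 <= k by rewrite mulr_ge0 // sqr_ge0.
exists ((n * n)%:R * ((n%:R * c) ^+ 2 * `|k%:M : 'M[R]_n|) ^+ 2), k%:M => M GM.
split=> [v|].
  have [N [GN NM MN]] := Gam_inv GM.
  have -> : form k%:M (v *m M) (v *m M) = k * fro2 (v *m M).
    by rewrite fro2_form /form mul_mx_scalar mulmx1 -scalemxAl mxE.
  apply: le_trans (fro2_le_norm _) _; rewrite mul1n /k -mulrA ler_wpM2l //.
  apply: (@le_trans _ _ ((n%:R * c) ^+ 2 * `|v *m M| ^+ 2)); last first.
    by rewrite ler_wpM2l ?sqr_ge0 // norm_fro2.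
  rewrite -exprMn ler_sqr ?nnegrE ?mulr_ge0 //.
  rewrite -{1}[v]mulmx1 -MN mulmxA (le_trans (mulmx_norm_le _ _)) //.
  by rewrite -mulrA ler_wpM2l // mulrC ler_wpM2r // Gam_bounded.
apply: le_trans (fro2_le_norm _) _; rewrite ler_wpM2l //.
rewrite ler_sqr ?nnegrE ?mulr_ge0 ?sqr_ge0 //; apply: congr_norm_le.
  exact: Gam_bounded.
exact: le_trans (trmx_norm_le _) (Gam_bounded GM).
Qed.

(** Uniform strict convexity of the supremum over the orbit comes from this
bound: [S] is recovered from [M *m S *m M^T] by a bounded matrix. *)
Lemma fro2_congr_bound S : S != 0 -> exists2 d, 0 < d &
  forall M, Gam M -> d <= fro2 (M *m S *m M^T).
Proof.
move=> S0; pose k := (n%:R * c) ^+ 2 + 1.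
have k0 : 0 < k by rewrite ltr_wpDl // sqr_ge0.
exists ((`|S| / k) ^+ 2); first by rewrite exprn_gt0 // divr_gt0 // normr_gt0.
move=> M GM; apply: le_trans (norm_fro2 _).
have [N [GN NM MN]] := Gam_inv GM.
rewrite ler_sqr ?nnegrE ?divr_ge0 // ?(ltW k0) // ler_pdivrMr //.
have {1}-> : S = N *m (M *m S *m M^T) *m N^T.
  by rewrite !mulmxA NM mul1mx -mulmxA -trmx_mul NM trmx1 mulmx1.
apply: (@le_trans _ _ ((n%:R * c) ^+ 2 * `|M *m S *m M^T|)).
  apply: congr_norm_le; first exact: Gam_bounded.
  exact: le_trans (trmx_norm_le _) (Gam_bounded GN).
by rewrite mulrC ler_wpM2l // /k lerDl.
Qed.

Lemma closed_le_fun (T : topologicalType) (g h : T -> R) :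
  continuous g -> continuous h -> closed [set p | g p <= h p].
Proof.
move=> cg ch; have -> : [set p | g p <= h p] = (g - h) @^-1` [set x | x <= 0].
  by apply/seteqP; split=> p /=; rewrite -[(g - h) p]/(g p - h p) subr_le0.
apply: preimage_closed; last exact: closed_le.
by move=> p _; apply: cvgB; [exact: cg|exact: ch].
Qed.

Lemma closed_forall (T : topologicalType) (I : Type) (A : I -> set T) :
  (forall i, closed (A i)) -> closed [set p | forall i, A i p].
Proof.
move=> cA; have -> : [set p | forall i, A i p] = \bigcap_(i in [set: I]) A i.
  by apply/seteqP; split => p Ap i => [_|]; exact: Ap.
by apply: closed_bigI => i _; exact: cA.
Qed.

Lemma vec_mx_continuous : continuous (vec_mx : 'rV[R]_(n * n) -> 'M[R]_n).
Proof.
move=> s; apply: (@cvg_mx R _ (nbhs s) _) => i j; rewrite mxE; under eq_fun do rewrite mxE.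
exact: matrix_normedtype.coord_continuous.
Qed.

Lemma admissible_closed :
  closed [set p : 'rV[R]_(n * n) * R | admissible p.2 (vec_mx p.1)].
Proof.
have cv : continuous (fun p : 'rV[R]_(n * n) * R => vec_mx p.1).
  move=> [s r]; apply: (@cvg_comp _ _ _ fst vec_mx _ (nbhs s)).
    exact: cvg_fst.
  exact: vec_mx_continuous.
apply: closed_forall => M; apply: closed_forall => GM.
apply: closedI; first (apply: closed_forall => v; apply: closed_le_fun => p).
- exact: cvg_cst.
- apply: cvg_entry; apply: cvg_mulmx; last exact: cvg_cst.
  by apply: cvg_mulmx; [exact: cvg_cst|exact: cv].
- apply: closed_le_fun => p; last exact: cvg_snd.
  apply: cvg_fro2; apply: cvg_mulmx; last exact: cvg_cst.
  by apply: cvg_mulmx; [exact: cvg_cst|exact: cv].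
Qed.

Lemma admissible_ge r S : admissible r S -> fro2 S <= r.
Proof. by move=> /(_ _ Gam1)[_]; rewrite mul1mx trmx1 mulmx1. Qed.

(** The pairs [(S, r)] with [S] admissible for [r] form a closed set, compact
once [r] is bounded above; the coordinate [r] attains its minimum on it. *)
Lemma admissible_min : exists r S, admissible r S /\
  forall r' S', admissible r' S' -> r <= r'.
Proof.
have [r0 [S0 AS0]] := admissible_ex.
have r00 : 0 <= r0 := le_trans (fro2_ge0 _) (admissible_ge AS0).
pose K := [set s : 'rV[R]_(n * n) | forall i, `[- (r0 + 1), r0 + 1]%classic (s 0 i)].
pose A := [set p : 'rV[R]_(n * n) * R | admissible p.2 (vec_mx p.1)].
pose Z := A `&` (snd @^-1` [set x | x <= r0]).
have ZK r S : admissible r S -> r <= r0 -> K (mxvec S).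
  move=> AS rr0 i; rewrite /= in_itv /= -ler_norml.
  case/mxvec_indexP: i => i j; rewrite mxvecE.
  have := le_trans (le_trans (entry_fro2 S i j) (admissible_ge AS)) rr0.
  rewrite -real_normK ?num_real // => Sr0.
  by rewrite -ler_sqr ?nnegrE ?addr_ge0 //; nra.
have cZ : compact Z.
  apply: (@subclosed_compact _ _ (K `*` `[0, r0]%classic)).
  - apply: closedI; first exact: admissible_closed.
    apply: preimage_closed; last exact: closed_le.
    by move=> [s r] _; exact: (@cvg_snd _ _ (nbhs s) (nbhs r) _).
  - apply: compact_setX; last exact: segment_compact.
    apply: (@rV_compact R _ (fun=> `[- (r0 + 1), r0 + 1]%classic)).
    by move=> i; exact: segment_compact.
  - move=> [s r] [/= AS rr0]; split => /=.
      by rewrite -[s]vec_mxK; exact: ZK AS rr0.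
    by rewrite in_itv /= rr0 (le_trans (fro2_ge0 _) (admissible_ge AS)).
have Z0 : Z !=set0.
  by exists (mxvec S0, r0); split; rewrite /A /= ?mxvecK ?lexx.
have cs : {within Z, continuous (snd : 'rV[R]_(n * n) * R -> R)}.
  by apply: continuous_subspaceT => -[s r]; exact: (@cvg_snd _ _ (nbhs s) (nbhs r) _).
have [[s r] /set_mem[/= AS rr0] rmin] := compact_EVT_min Z0 cZ cs.
exists r, (vec_mx s); split=> // r' S' AS'; have [r'r0|/ltW] := leP r' r0.
  by apply: (rmin (mxvec S', r')); apply: mem_set; split; rewrite /A /= ?mxvecK.
by apply: le_trans.
Qed.

(** If two matrices reached the minimal radius, the parallelogram law would put
their midpoint in a smaller ball. *)
Lemma admissible_unique r S S' :
  (forall r' S', admissible r' S' -> r <= r') ->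
  admissible r S -> admissible r S' -> S = S'.
Proof.
move=> rmin AS AS'; apply/eqP; rewrite -subr_eq0; apply/negP => /negP/fro2_congr_bound.
move=> [d d0 dP]; suff /rmin : admissible (r - d / 4) (2^-1 *: (S + S')) by lra.
move=> M GM; have [AS1 AS2] := AS M GM; have [AS1' AS2'] := AS' M GM; split.
  move=> v; have := AS1 v; have := AS1' v.
  set w := v *m M; have -> : form (2^-1 *: (S + S')) w w = 2^-1 * (form S w w + form S' w w).
    by rewrite /form -scalemxAr -scalemxAl mulmxDr mulmxDl !mxE.
  lra.
have -> : M *m (2^-1 *: (S + S')) *m M^T = 2^-1 *: (M *m S *m M^T + M *m S' *m M^T).
  by rewrite -scalemxAr -scalemxAl mulmxDr mulmxDl.
have := dP M GM; rewrite fro2_midpoint mulmxBr mulmxBl.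
lra.
Qed.

(** The group permutes the minimisers, of which there is only one; transposition
fixes it as well. *)
Lemma invariant_form : exists S, posdef S /\ forall M, Gam M -> M *m S *m M^T = S.
Proof.
have [r [S [AS rmin]]] := admissible_min.
have uniq := admissible_unique rmin.
exists S; split; last first.
  by move=> M GM; apply/esym/uniq => //; exact: admissible_act.
split; first by apply: uniq => //; exact: admissible_tr.
move=> v v0; have [/(_ v) + _] := AS _ Gam1; rewrite mulmx1.
apply: lt_le_trans; rewrite lt_neqAle fro2_ge0 andbT eq_sym.
by apply: contra v0 => /eqP/fro2_eq0 ->.
Qed.

End InvariantForm.

(** * Bilinear antisymmetric brackets *)

Section BilinearBracket.
Variables (R : realType) (n : nat).
Notation V := 'rV[R]_n.

Lemma mul_rV_lin1_fun m (f : V -> 'rV[R]_m) (x : V) :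
  (forall k u v, f (k *: u + v) = k *: f u + f v) -> x *m lin1_mx f = f x.
Proof.
move=> lf; pose flM := GRing.isLinear.Build _ _ _ _ f lf.
pose fL : {linear V -> 'rV[R]_m} := HB.pack f flM.
exact: (mul_rV_lin1 fL).
Qed.

Lemma mulmx_row_ext (A B : 'M[R]_n) : (forall v : V, v *m A = v *m B) -> A = B.
Proof. by move=> AB; apply/row_matrixP => i; rewrite !rowE. Qed.

Lemma bilinear_form (f : V -> V -> R) :
  (forall k x z y, f (k *: x + z) y = k * f x y + f z y) ->
  (forall k x z y, f y (k *: x + z) = k * f y x + f y z) ->
  exists S, forall x y, f x y = form S x y.
Proof.
move=> fl fr; pose g (x : V) : V := \row_j f x (delta_mx 0 j).
exists (lin1_mx g) => x y; rewrite /form mul_rV_lin1_fun; last first.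
  by move=> k u v; apply/rowP => j; rewrite !mxE fl.
have -> : f x y = f x (\sum_j y 0 j *: delta_mx 0 j) by rewrite -row_sum_delta.
rewrite mxE; elim/big_rec2: _ => [|j u v _ IH].
  by have := fr (-1) 0 0 x; rewrite scaler0 addr0 mulN1r addNr.
by rewrite fr IH !mxE mulrC.
Qed.

Variable br : V -> V -> V.
Hypothesis br_linearr : forall k x z y, br y (k *: x + z) = k *: br y x + br y z.
Hypothesis br_anti : forall x y, br x y = - br y x.

Lemma br_linearl k x z y : br (k *: x + z) y = k *: br x y + br z y.
Proof.
by rewrite (br_anti _ y) br_linearr (br_anti x) (br_anti z) opprD scalerN.
Qed.

Lemma br0r y : br y 0 = 0.
Proof. by have := br_linearr (-1) 0 0 y; rewrite scaler0 addr0 scaleN1r addNr. Qed.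

Lemma br0l y : br 0 y = 0.
Proof. by rewrite br_anti br0r oppr0. Qed.

Lemma brNr x y : br y (- x) = - br y x.
Proof. by have := br_linearr (-1) x 0 y; rewrite !scaleN1r br0r !addr0. Qed.

Lemma brNl x y : br (- x) y = - br x y.
Proof. by rewrite (br_anti (- x)) (br_anti x) brNr. Qed.

Lemma brBl x z y : br (x - z) y = br x y - br z y.
Proof. by rewrite -[x]scale1r br_linearl brNl !scale1r. Qed.

Definition ad x : 'M[R]_n := lin1_mx (br x).

Lemma mul_ad x v : v *m ad x = br x v.
Proof. by apply: mul_rV_lin1_fun => k u w; exact: br_linearr. Qed.

Lemma ad_linear k x y : ad (k *: x + y) = k *: ad x + ad y.
Proof.
by apply: mulmx_row_ext => v; rewrite mulmxDr -scalemxAr !mul_ad br_linearl.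
Qed.

Lemma killing_ad x y : killing br x y = \tr (ad y *m ad x).
Proof.
congr (\tr _); apply: mulmx_row_ext => v; rewrite mulmxA !mul_ad.
by apply: mul_rV_lin1_fun => k u w /=; rewrite !br_linearr.
Qed.

Lemma killing_form : exists S, forall x y, - killing br x y = form S x y.
Proof.
apply: bilinear_form => k x z y; rewrite !killing_ad ad_linear.
  by rewrite mulmxDr -scalemxAr mxtraceD mxtraceZ opprD mulrN.
by rewrite mulmxDl -scalemxAl mxtraceD mxtraceZ opprD mulrN.
Qed.

Lemma mem_brv (A B : {vspace V}) x y : x \in A -> y \in B -> br x y \in brv br A B.
Proof.
move=> xA yB; rewrite (coord_vbasis xA).
elim/big_rec: _ => [|i u _ IHu]; first by rewrite br0l mem0v.
rewrite br_linearl rpredD // rpredZ // (coord_vbasis yB).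
elim/big_rec: _ => [|j v _ IHv]; first by rewrite br0r mem0v.
rewrite br_linearr rpredD // rpredZ // memv_span //.
by apply/allpairsP; exists ((vbasis A)`_i, (vbasis B)`_j); rewrite /= !mem_nth ?size_tuple.
Qed.

Lemma brv_eq0 (A B : {vspace V}) :
  (forall x y, x \in A -> y \in B -> br x y = 0) -> brv br A B = 0%VS.
Proof.
move=> AB0; apply/eqP; rewrite -subv0; apply/span_subvP => z.
by move=> /allpairsP[[x y] /= [/vbasis_mem xA /vbasis_mem yB ->]]; rewrite AB0 // mem0v.
Qed.

(** The line spanned by a central vector is an abelian ideal. *)
Lemma semisimple_center x : semisimple br -> (forall y, br x y = 0) -> x = 0.
Proof.
move=> ss x0; have xI u v : u \in <[x]>%VS -> br u v = 0.
  by move=> /vlineP[k ->]; rewrite -[k *: x]addr0 br_linearl x0 br0l scaler0 addr0.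
have : <[x]>%VS = 0%VS.
  apply: ss => [u v /xI vu|]; first by rewrite br_anti vu oppr0 mem0v.
  by exists 1%N => /=; apply: brv_eq0 => u v /xI uv _; exact: uv.
by move=> x0'; apply/eqP; rewrite -memv0 -x0' memv_line.
Qed.

Section InvariantBracketForm.
Variable K : 'M[R]_n.
Hypothesis pK : posdef K.
Hypothesis skewK : forall z v w, form K (br z v) w = - form K v (br z w).

(** If [br C D_(m+1) = 0], where [D_(m+1) = br C D_m], then every generator
[e = br x y] of [D_(m+1)] satisfies [K(e, e) = - K(y, br x e) = 0].  Hence the
lower central series vanishes from its first step on. *)
Lemma nilpotent_abelian (C : {vspace V}) :
  nilpotent_subalgebra br C -> forall x y, x \in C -> y \in C -> br x y = 0.
Proof.
move=> [k Ck0]; pose D k := iter k (brv br C) C.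
have step m : D m.+2 = 0%VS -> D m.+1 = 0%VS.
  move=> Dm; apply: brv_eq0 => x y xC yD; apply: (form_eq0 pK).
  have bD : br x y \in D m.+1 by exact: mem_brv.
  have : br x (br x y) \in D m.+2 by exact: mem_brv.
  rewrite Dm memv0 => /eqP b0.
  by rewrite skewK b0 form0r oppr0.
have D1 : D 1%N = 0%VS.
  case: k Ck0 => [/= C0|k].
    by apply: brv_eq0 => x y; rewrite C0 memv0 => /eqP-> _; rewrite br0l.
  by elim: k => // k IHk /step.
by move=> x y xC yC; apply/eqP; rewrite -memv0 -D1 mem_brv.
Qed.

Lemma vspace_projection (C : {vspace V}) : exists P : 'M[R]_n,
  forall x, x *m P \in C /\ forall c, c \in C -> form K (x - x *m P) c = 0.
Proof.
pose E : 'M[R]_(\dim C, n) := \matrix_i (vbasis C)`_i.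
have mulE (w : 'rV_(\dim C)) : w *m E = \sum_i w 0 i *: (vbasis C)`_i.
  by rewrite mulmx_sum_row; apply: eq_bigr => i _; rewrite rowK.
have fE : row_free E.
  apply: inj_row_free => w; rewrite mulE => w0; apply/rowP => i; rewrite mxE.
  by have /freeP/(_ _ w0) := basis_free (vbasisP C).
have [Q QE] := orthogonal_projection pK fE.
exists (Q *m E) => x; rewrite mulmxA; split=> [|c cC].
  by rewrite mulE rpred_sum // => i _; rewrite rpredZ // vbasis_mem // mem_nth // size_tuple.
have -> : c = (\row_i vector.coord (vbasis C) i c) *m E.
  by rewrite mulE {1}(coord_vbasis cC); apply: eq_bigr => i _; rewrite mxE.
exact: QE.
Qed.

End InvariantBracketForm.
End BilinearBracket.

(** * Compact groups of automorphisms *)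

Section CompactAutomorphismGroup.
Variables (R : realType) (n : nat).
Notation V := 'rV[R]_n.
Variable br : V -> V -> V.
Hypothesis br_linearr : forall k x z y, br y (k *: x + z) = k *: br y x + br y z.
Hypothesis br_anti : forall x y, br x y = - br y x.
Variable Gam : set 'M[R]_n.
Hypothesis Gam1 : Gam 1%:M.
Hypothesis GamM : forall M N, Gam M -> Gam N -> Gam (M *m N).
Hypothesis GamV : forall M, Gam M -> exists2 N, Gam N & N *m M = 1%:M.
Hypothesis Gam_compact : compact Gam.
Hypothesis Gam_aut : forall M, Gam M -> forall x y, br (x *m M) (y *m M) = br x y *m M.
Hypothesis Gam_tangent : forall z, exists M : R -> 'M[R]_n, (forall t, Gam (M t)) /\
  (fun t => t^-1 *: (M t - 1%:M)) @ 0^'+ --> ad br z.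

Notation ad := (ad br).
Let mulad := mul_ad br_linearr.

Lemma Gam_bounded : exists c, forall M, Gam M -> `|M| <= c.
Proof.
have [c [_ cP]] := compact_bounded Gam_compact.
by exists (c + 1) => M GM; apply: (cP (c + 1)) GM; rewrite ltrDl.
Qed.

(** The inverse curve has the opposite tangent vector:
[N - 1 = - N (M - 1)], and [N] tends to 1 because the group is bounded. *)
Lemma Gam_curve z : exists M N : R -> 'M[R]_n,
  [/\ forall t, [/\ Gam (M t), Gam (N t) & M t *m N t = 1%:M],
      (fun t => t^-1 *: (M t - 1%:M)) @ 0^'+ --> ad z,
      (fun t => t^-1 *: (N t - 1%:M)) @ 0^'+ --> - ad z &
      M @ 0^'+ --> (1%:M : 'M[R]_n)].
Proof.
have [M [GM Mz]] := Gam_tangent z; have [c cP] := Gam_bounded.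
have /boolp.choice[N NP] : forall t, exists N, Gam N /\ M t *m N = 1%:M.
  by move=> t; have [N GN NM] := GamV (GM t); exists N; split => //; exact: mulmx1C.
have M1 : M @ 0^'+ --> (1%:M : 'M[R]_n).
  have t0 : (fun t : R => t) @ 0^'+ --> (0 : R) by apply: cvg_at_right_filter; exact: cvg_id.
  have : (fun t => t *: (t^-1 *: (M t - 1%:M)) + 1%:M) @ 0^'+ --> 0 *: ad z + (1%:M : 'M[R]_n).
    by apply: cvgD; [exact: cvgZ t0 Mz|exact: cvg_cst].
  rewrite scale0r add0r; apply: cvg_trans; apply: near_eq_cvg; near=> t.
  have t0' : 0 < t by near: t; exact: nbhs_right_gt.
  by rewrite scalerA mulfV ?scale1r ?subrK // gt_eqF.
have NE t : N t - 1%:M = - (N t *m (M t - 1%:M)).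
  by rewrite mulmxBr mulmx1 (mulmx1C (NP t).2) opprB.
have N1 : N @ 0^'+ --> (1%:M : 'M[R]_n).
  apply/cvgrPdist_le => /= e e0; near=> t.
  rewrite distrC NE normrN (le_trans (mulmx_norm_le _ _)) //.
  apply: (@le_trans _ _ (n%:R * c * `|M t - 1%:M|)).
    by rewrite -mulrA ler_wpM2l // ler_wpM2r // cP //; have [] := NP t.
  have k0 : 0 < n%:R * `|c| + 1 by rewrite ltr_wpDl // mulr_ge0.
  have : `|1%:M - M t| <= e / (n%:R * `|c| + 1).
    by near: t; apply: (cvgrPdist_le _ _).1 M1 _ _; rewrite divr_gt0.
  rewrite ler_pdivlMr // distrC mulrC; apply: le_trans.
  rewrite ler_wpM2r // (le_trans (ler_norm _)) // normrM ger0_norm // lerDl //.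
exists M, N; split => //; first by move=> t; have [] := NP t.
have -> : - ad z = - (1%:M *m ad z) by rewrite mul1mx.
have -> : (fun t => t^-1 *: (N t - 1%:M)) = (fun t => - (N t *m (t^-1 *: (M t - 1%:M)))).
  by apply/funext => t; rewrite NE scalerN scalemxAr.
exact: cvgN (cvg_mulmx N1 Mz).
Unshelve. all: by end_near. Qed.

(** Differentiate [form S (v M) w = form S v (w M^-1)] along a curve. *)
Lemma invariant_form_skew S : (forall M, Gam M -> M *m S *m M^T = S) ->
  forall z v w, form S (br z v) w = - form S v (br z w).
Proof.
move=> SG z v w; have [M [N [GMN Mz Nz _]]] := Gam_curve z.
have l1 : (fun t => form S (v *m (t^-1 *: (M t - 1%:M))) w) @ 0^'+ --> form S (br z v) w.
  rewrite -mulad; apply: cvg_form; last exact: cvg_cst.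
  by apply: cvg_mulmx Mz; exact: cvg_cst.
have l2 : (fun t => form S v (w *m (t^-1 *: (N t - 1%:M)))) @ 0^'+ --> - form S v (br z w).
  rewrite -formNr -mulad -mulmxN; apply: cvg_form; first exact: cvg_cst.
  by apply: cvg_mulmx Nz; exact: cvg_cst.
suff l3 : (fun t => form S (v *m (t^-1 *: (M t - 1%:M))) w) @ 0^'+
  --> - form S v (br z w) by exact: (norm_cvg_unique l1 l3).
apply: cvg_trans l2; apply: near_eq_cvg; near=> t; have [GM GN MN] := GMN t.
rewrite -!scalemxAr formZl formZr !mulmxBr !mulmx1; congr (_ * _).
rewrite !(formDl, formDr, formNl, formNr); congr (_ - _).
rewrite form_mull form_mulr; congr (form _ v w).
rewrite -[in LHS](SG _ GM).
by rewrite -!mulmxA -trmx_mul (mulmx1C MN) trmx1 mulmx1.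
Unshelve. all: by end_near. Qed.

Lemma Gam_ad M z : Gam M -> M *m ad (z *m M) = ad z *m M.
Proof. by move=> GM; apply: mulmx_row_ext => v; rewrite !mulmxA !mulad Gam_aut. Qed.

Lemma cvg_ad {T : Type} {F : set_system T} {FF : Filter F} (x : T -> V) (l : V) :
  x @ F --> l -> (fun t => ad (x t)) @ F --> ad l.
Proof.
move=> xl; apply: cvg_mx => i j.
have adE u : ad u i j = - (u *m ad (delta_mx 0 i)) 0 j.
  have -> : ad u i j = row i (ad u) 0 j by rewrite [RHS]mxE.
  by rewrite rowE mulad br_anti mxE mulad.
under eq_fun do rewrite adE; rewrite adE.
by apply: cvgN; apply: cvg_entry; apply: cvg_mulmx xl _; exact: cvg_cst.
Qed.

(** Differentiate [ad p *m M = M *m ad (p *m M)] along a curve tangent to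
[ad q]. *)
Lemma jacobi p q : ad p *m ad q = ad q *m ad p + ad (br q p).
Proof.
have [M [N [GMN Mz _ M1]]] := Gam_curve q.
have pM : (fun t => p *m M t) @ 0^'+ --> p.
  by rewrite -[X in _ --> X]mulmx1; apply: cvg_mulmx M1; exact: cvg_cst.
have l1 : (fun t => ad p *m (t^-1 *: (M t - 1%:M))) @ 0^'+ --> ad p *m ad q.
  by apply: cvg_mulmx Mz; exact: cvg_cst.
have l2 : (fun t => (t^-1 *: (M t - 1%:M)) *m ad (p *m M t) +
    ad (p *m (t^-1 *: (M t - 1%:M)))) @ 0^'+ --> ad q *m ad p + ad (br q p).
  apply: cvgD; first exact: cvg_mulmx Mz (cvg_ad pM).
  rewrite -mulad; apply: cvg_ad; apply: cvg_mulmx Mz; exact: cvg_cst.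
suff l3 : (fun t => ad p *m (t^-1 *: (M t - 1%:M))) @ 0^'+
  --> ad q *m ad p + ad (br q p) by exact: (norm_cvg_unique l1 l3).
apply: cvg_trans l2; apply: near_eq_cvg; near=> t; have [GM GN MN] := GMN t.
have adZ k x : ad (k *: x) = k *: ad x.
  by rewrite -[k *: x]addr0 ad_linear //; apply: mulmx_row_ext => v;
     rewrite mulmxDr mulad br0l // addr0.
rewrite -!scalemxAr -scalemxAl adZ -scalerDr; congr (_ *: _).
rewrite mulmxBl mul1mx Gam_ad // mulmxBr mulmx1 mulmxBr mulmx1.
have -> : ad (p *m M t - p) = ad (p *m M t) - ad p.
  by rewrite addrC -scaleN1r ad_linear // scaleN1r addrC.
by rewrite addrA subrK.
Unshelve. all: by end_near. Qed.

Lemma ad_commute u v : br u v = 0 -> ad u *m ad v = ad v *m ad u.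
Proof.
move=> uv0; rewrite jacobi br_anti uv0 oppr0.
have -> : ad 0 = 0 by apply: mulmx_row_ext => w; rewrite mulad br0l // mulmx0.
by rewrite addr0.
Qed.

Lemma br_commute u v w : br u v = 0 -> br u (br v w) = br v (br u w).
Proof. by move=> /ad_commute uv; rewrite -!mulad -!mulmxA uv. Qed.

Lemma killing_invariant M : Gam M -> forall x y,
  killing br (x *m M) (y *m M) = killing br x y.
Proof.
move=> GM x y; have [N GN NM] := GamV GM; rewrite !killing_ad //.
have adE z : ad (z *m M) = N *m ad z *m M by rewrite -mulmxA -Gam_ad // mulmxA NM mul1mx.
have MN := mulmx1C NM.
have -> : ad (y *m M) *m ad (x *m M) = N *m (ad y *m ad x *m M).
  by rewrite !adE -!mulmxA (mulmxA M) MN mul1mx.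
by rewrite mxtrace_mulC -(mulmxA _ M N) MN mulmx1.
Qed.

(** ** Variation of the length of the projection onto a subalgebra *)

Section ProjectionMinimum.
Variables (C : {vspace V}) (K P : 'M[R]_n) (y : V).
Hypothesis pK : posdef K.
Hypothesis K_killing : forall u v, - killing br u v = form K u v.
Hypothesis C_abelian : forall u v, u \in C -> v \in C -> br u v = 0.
Hypothesis P_proj : forall u,
  u *m P \in C /\ forall c, c \in C -> form K (u - u *m P) c = 0.
Hypothesis y_min : forall M, Gam M ->
  form K (y *m P) (y *m P) <= form K (y *m M *m P) (y *m M *m P).

Let p := y *m P.
Let symK := form_sym pK.

Lemma killing_form_skew z v w : form K (br z v) w = - form K v (br z w).
Proof.
apply: invariant_form_skew => M GM; apply: form_inj => u1 u2.
by rewrite -form_mulr -form_mull -!K_killing killing_invariant.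
Qed.

Let skewK := killing_form_skew.

Lemma form_proj u v : form K (u *m P) (v *m P) = form K u (v *m P).
Proof.
apply/eqP; rewrite -subr_eq0 -formNl -formDl -opprB formNl oppr_eq0.
by have [_ ->] := P_proj u; have [] := P_proj v.
Qed.

Lemma form_projr u : form K p (u *m P) = form K p u.
Proof. by rewrite symK form_proj symK. Qed.

Lemma proj_displacement M : form K (y *m M *m P) (y *m M *m P) = form K p p +
  2 * form K p (y *m (M - 1%:M)) +
  form K (y *m (M - 1%:M) *m P) (y *m (M - 1%:M) *m P).
Proof.
have -> : y *m M *m P = p + y *m (M - 1%:M) *m P.
  by rewrite mulmxBr mulmx1 mulmxBl addrC subrK.
rewrite !(formDl, formDr) [form K (_ *m P) p]symK form_projr; ring.
Qed.

Lemma first_variation z : 0 <= form K p (br z y).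
Proof.
have [M [N [GMN Mz Nz _]]] := Gam_curve z.
have l : (fun t : R => 2 * form K p (y *m (t^-1 *: (M t - 1%:M))) +
    t * form K (y *m (t^-1 *: (M t - 1%:M)) *m P)
               (y *m (t^-1 *: (M t - 1%:M)) *m P)) @ 0^'+
    --> 2 * form K p (br z y) + 0 * form K (br z y *m P) (br z y *m P).
  have t0 : (fun t : R => t) @ 0^'+ --> (0 : R).
    by apply: cvg_at_right_filter; exact: cvg_id.
  have yM : (fun t => y *m (t^-1 *: (M t - 1%:M))) @ 0^'+ --> br z y.
    by rewrite -mulad; apply: cvg_mulmx Mz; exact: cvg_cst.
  have yMP : (fun t => y *m (t^-1 *: (M t - 1%:M)) *m P) @ 0^'+ --> br z y *m P.
    by apply: cvg_mulmx yM _; exact: cvg_cst.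
  apply: cvgD; last exact: cvgM t0 (cvg_form yMP yMP).
  by apply: cvgM; [exact: cvg_cst|apply: cvg_form yM; exact: cvg_cst].
suff : 0 <= 2 * form K p (br z y) + 0 * form K (br z y *m P) (br z y *m P) by lra.
apply: (cvgr_to_ge l); near=> t.
have t0 : 0 < t by near: t; exact: nbhs_right_gt.
have [GM _ _] := GMN t; have := y_min GM; rewrite proj_displacement -/p.
rewrite -!scalemxAr -!scalemxAl !(formZl, formZr).
set u := form K p (y *m (M t - 1%:M)).
set w := form K (y *m (M t - 1%:M) *m P) _ => uw.
have -> : 2 * (t^-1 * u) + t * (t^-1 * (t^-1 * w)) = t^-1 * (2 * u + w).
  by field; rewrite gt_eqF.
by rewrite mulr_ge0 ?invr_ge0 ?(ltW t0) //; lra.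
Unshelve. all: by end_near. Qed.

(** The displacements along a curve and along its inverse are added, which
cancels their first-order parts; dividing by [t ^+ 2] gives the inequality. *)
Lemma second_variation z :
  0 <= form K p (br z (br z y)) + form K (br z y *m P) (br z y *m P).
Proof.
have [M [N [GMN Mz Nz _]]] := Gam_curve z.
pose dM t := t^-1 *: (M t - 1%:M); pose dN t := t^-1 *: (N t - 1%:M).
have yM : (fun t => y *m dM t) @ 0^'+ --> br z y.
  by rewrite -mulad; apply: cvg_mulmx Mz; exact: cvg_cst.
have yN : (fun t => y *m dN t) @ 0^'+ --> - br z y.
  by rewrite -mulad -mulmxN; apply: cvg_mulmx Nz; exact: cvg_cst.
have yMP : (fun t => y *m dM t *m P) @ 0^'+ --> br z y *m P.
  by apply: cvg_mulmx yM _; exact: cvg_cst.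
have yNP : (fun t => y *m dN t *m P) @ 0^'+ --> - br z y *m P.
  by apply: cvg_mulmx yN _; exact: cvg_cst.
have yMN : (fun t => y *m dM t *m dN t) @ 0^'+ --> - br z (br z y).
  by rewrite -[br z (br z y)]mulad -mulmxN; exact: cvg_mulmx yM Nz.
(* - (M - 1) (N - 1) = (M - 1) + (N - 1), so the first term collects the
   linear parts of the two displacements. *)
have l : (fun t => 2 * - form K p (y *m dM t *m dN t) +
    (form K (y *m dM t *m P) (y *m dM t *m P) +
     form K (y *m dN t *m P) (y *m dN t *m P))) @ 0^'+
    --> 2 * - form K p (- br z (br z y)) + (form K (br z y *m P) (br z y *m P) +
      form K (- br z y *m P) (- br z y *m P)).
  have cp : (fun=> p) @ (0 : R)^'+ --> p by exact: cvg_cst.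
  have c2 : (fun=> (2 : R)) @ (0 : R)^'+ --> (2 : R) by exact: cvg_cst.
  apply: cvgD; last exact: (cvgD (cvg_form yMP yMP) (cvg_form yNP yNP)).
  exact: (cvgM c2 (cvgN (cvg_form cp yMN))).
have : 0 <= 2 * - form K p (- br z (br z y)) + (form K (br z y *m P) (br z y *m P) +
      form K (- br z y *m P) (- br z y *m P)).
  apply: (cvgr_to_ge l); near=> t.
  have t0 : 0 < t by near: t; exact: nbhs_right_gt.
  have [GM GN MN] := GMN t.
  have := y_min GM; have := y_min GN; rewrite (proj_displacement (M t)) (proj_displacement (N t)) -/p.
  rewrite /dM /dN -!scalemxAr -!scalemxAl !(formZl, formZr).
  have -> : y *m (M t - 1%:M) *m (N t - 1%:M) =
      - (y *m (M t - 1%:M) + y *m (N t - 1%:M)).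
    rewrite -mulmxDr -mulmxN -mulmxA; congr (_ *m _).
    rewrite mulmxBr mulmx1 mulmxBl mul1mx MN.
    by rewrite [RHS]opprD [RHS]addrC [- (N t - 1%:M)]opprB.
  rewrite formNr formDr.
  set uM := form K p (y *m (M t - 1%:M)); set uN := form K p (y *m (N t - 1%:M)).
  set wM := form K (y *m (M t - 1%:M) *m P) _.
  set wN := form K (y *m (N t - 1%:M) *m P) _ => uwN uwM.
  have -> : 2 * - (t^-1 * (t^-1 * - (uM + uN))) +
    (t^-1 * (t^-1 * wM) + t^-1 * (t^-1 * wN)) =
    t^-1 * (t^-1 * ((2 * uM + wM) + (2 * uN + wN))) by ring.
  by rewrite !mulr_ge0 ?invr_ge0 ?(ltW t0) //; lra.
rewrite mulNmx !(formNl, formNr); lra.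
Unshelve. all: by end_near. Qed.

Lemma proj_commute : br p y = 0.
Proof.
have first0 z : form K p (br z y) = 0.
  apply/eqP; rewrite eq_le first_variation andbT -oppr_ge0 -formNr.
  by rewrite -(brNl br_linearr br_anti); exact: first_variation.
apply: (form_nondegenerate pK) => z.
by rewrite br_anti formNl skewK opprK br_anti formNr first0 oppr0.
Qed.

(** Here [br z y] is orthogonal to [C]: for [c] in [C], [K([z, y], c)] equals
[K(z, [y, c])], and [y, c] lies in the kernel of [ad p], since [ad p] commutes
with [ad y] and kills [c]. *)
Lemma second_variation_orth z : (forall k, br p k = 0 -> form K z k = 0) ->
  0 <= form K p (br z (br z y)).
Proof.
move=> zk; have := second_variation z.
suff -> : form K (br z y *m P) (br z y *m P) = 0 by rewrite addr0.
rewrite form_proj; have [cC _] := P_proj (br z y).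
move: cC; set c := _ *m P => cC.
have [pC _] := P_proj y; rewrite -/p in pC.
rewrite br_anti formNl skewK opprK zk //.
by rewrite br_commute ?proj_commute // (C_abelian pC cC) br0r.
Qed.

Lemma ker_ad_split z : exists z0,
  br p z0 = 0 /\ forall k, br p k = 0 -> form K (z - z0) k = 0.
Proof.
have [Q QE] := orthogonal_projection pK (row_base_free (kermx (ad p))).
exists (z *m Q *m row_base (kermx (ad p))); split=> [|k].
  rewrite -mulad; apply/sub_kermxP; rewrite (submx_trans (submxMl _ _)) //.
  by rewrite eq_row_base.
rewrite -mulad => /sub_kermxP; rewrite -(eq_row_base (kermx (ad p))).
by move=> /submxP[w ->]; exact: QE.
Qed.

(** Only the component [z - z0] of [z] matters: [[z, p] = [z - z0, p]], and
[[z, y]] differs from [[z - z0, y]] by [[z0, y]], which is orthogonal to the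
range of [ad p] because [ad p] commutes with [ad z0] and kills [y]. *)
Lemma form_ad_proj_ge0 z : 0 <= form K (br p (br y z)) z.
Proof.
have [z0 [pz0 zz0]] := ker_ad_split z.
have z1 : br z p = br (z - z0) p.
  by rewrite brBl // (br_anti z0) pz0 oppr0 subr0.
have := second_variation_orth zz0.
suff -> : form K p (br (z - z0) (br (z - z0) y)) = form K (br p (br y z)) z by [].
have -> : form K p (br (z - z0) (br (z - z0) y)) =
    - form K (br z p) (br (z - z0) y) by rewrite z1 skewK opprK.
rewrite (brBl br_linearr br_anti z) formDr formNr.
have -> : form K (br z p) (br z0 y) = 0.
  by rewrite br_anti formNl skewK opprK br_commute // proj_commute br0r // form0r.
by rewrite subr0 (br_anti z) (br_anti z y) formNl formNr opprK skewK opprK symK.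
Qed.

(** By [form_ad_proj_ge0] the trace of [ad y *m ad p] is nonnegative, and it is
[- K(p, y) = - K(p, p)]. *)
Lemma minimal_proj_eq0 : p = 0.
Proof.
have tr_ge0 : 0 <= \tr (ad y *m ad p).
  by apply: (mxtrace_ge0 pK) => z; rewrite mulmxA !mulad form_ad_proj_ge0.
apply: (form_eq0 pK); move: tr_ge0; rewrite -killing_ad // -oppr_le0 K_killing.
by rewrite symK -form_proj.
Qed.

End ProjectionMinimum.

Hypothesis br_ss : semisimple br.

(** An inner product invariant under the group makes every [ad x] skew. *)
Lemma killing_posdef : exists2 K, posdef K & forall x y, - killing br x y = form K x y.
Proof.
have [K KE] := killing_form br_linearr br_anti; exists K => //.
have [c cP] := Gam_bounded.
have [S [pS SG]] := invariant_form Gam1 GamM GamV cP.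
have skewS := invariant_form_skew SG.
have symK x y : form K x y = form K y x.
  by rewrite -!KE !killing_ad // mxtrace_mulC.
split; first by apply: form_inj => x y; rewrite form_tr symK.
move=> x x0; have skewx v w : form S (v *m ad x) w = - form S v (w *m ad x).
  by rewrite !mulad.
have [tr_le tr0] := skew_mxtrace_sqr pS skewx.
rewrite -KE killing_ad // oppr_gt0 lt_neqAle tr_le andbT.
apply: contra x0 => /eqP /tr0 adx; apply/eqP.
by apply: semisimple_center br_ss _ => // y; rewrite -mulad adx mulmx0.
Qed.

(** [M] minimises the length of the projection of [x *m M] onto [C]. *)
Theorem compact_orbit_meets_orth (C : {vspace V}) x :
  nilpotent_subalgebra br C ->
  exists2 M, Gam M & killing_orth br C (x *m M).
Proof.
move=> nilC; have [K pK KE] := killing_posdef.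
have C_abelian := nilpotent_abelian br_linearr br_anti pK
  (killing_form_skew KE) nilC.
have [P PC] := vspace_projection pK C.
pose f (M : 'M[R]_n) := form K (x *m M *m P) (x *m M *m P).
have cf : continuous f.
  move=> M; have c1 : (fun N : 'M[R]_n => x *m N *m P) @ M --> x *m M *m P.
    apply: (@cvg_mulmx R _ (nbhs M) _); last exact: cvg_cst.
    apply: (@cvg_mulmx R _ (nbhs M) _ _ _ _ (fun=> x) id); first exact: cvg_cst.
    exact: cvg_id.
  exact: (@cvg_form R _ (nbhs M) _ _ K _ _ _ _ c1 c1).
have Gam0 : Gam !=set0 by exists 1%:M.
have [M0 /set_mem GM0 M0_min] :=
  compact_EVT_min Gam0 Gam_compact (continuous_subspaceT cf).
exists M0 => // c cC.
have y_min M : Gam M -> form K (x *m M0 *m P) (x *m M0 *m P) <=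
    form K (x *m M0 *m M *m P) (x *m M0 *m M *m P).
  by move=> GM; have := M0_min _ (mem_set (GamM GM0 GM)); rewrite /f !mulmxA.
have p0 := minimal_proj_eq0 pK KE C_abelian PC y_min.
by rewrite KE; have [_ /(_ _ cC)] := PC (x *m M0); rewrite p0 subr0.
Qed.

End CompactAutomorphismGroup.

(** * The group of adjoint matrices *)

Section AdjointMatrices.
Variables (R : realType) (n : nat) (G : lieGroupType R n) (a : chart R n G).
Hypotheses (Aa : atlas a) (a1 : dom a 1%g).
Notation V := 'rV[R]_n.
Notation u0 := (coord a 1%g).

(** The matrix acts on row vectors from the right, so [Ad_mx] reverses products
([Ad_mxM]). *)
Definition Ad_mx (g : G) : 'M[R]_n := lin1_mx (Ad a g).

Lemma mul_Ad_mx g (X : V) : X *m Ad_mx g = Ad a g X.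
Proof. by rewrite mul_rV_lin1. Qed.

Lemma Ad_mxE g i j : Ad_mx g i j = Ad a g (delta_mx 0 i) 0 j.
Proof. by rewrite -mul_Ad_mx -rowE [RHS]mxE. Qed.

Lemma Ad_mx1 : Ad_mx 1%g = 1%:M.
Proof. by apply: mulmx_row_ext => v; rewrite mul_Ad_mx Ad1 // mulmx1. Qed.

Lemma Ad_mxM g h : Ad_mx (g * h)%g = Ad_mx h *m Ad_mx g.
Proof. 
apply: mulmx_row_ext => v; apply: etrans (mul_Ad_mx _ v) _.
apply: etrans (AdM Aa a1 g h v) _; rewrite mulmxA.
apply: etrans (esym (mul_Ad_mx g _)) _; congr (_ *m _).
exact: esym (mul_Ad_mx h v).
Qed.

Lemma Ad_mx_continuous : continuous Ad_mx.
Proof.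
move=> g; apply: (@cvg_mx R _ (nbhs g) _) => i j.
under eq_fun do rewrite Ad_mxE; rewrite Ad_mxE; apply: cvg_entry.
exact: Ad_continuous.
Qed.

Lemma Ad_mx_tangent z :
  (fun t : R => t^-1 *: (Ad_mx (param a (t *: z + u0)) - 1%:M)) @ 0^'+
    --> ad (lie_bracket a) z.
Proof.
apply: cvg_mx => i j.
have adij : ad (lie_bracket a) z i j = lie_bracket a z (delta_mx 0 i) 0 j.
  by rewrite -(mul_ad (lie_bracket_linearr Aa a1)) -rowE [RHS]mxE.
have eij (t : R) : (t^-1 *: (Ad_mx (param a (t *: z + u0)) - 1%:M)) i j =
    (t^-1 *: (Ad a (param a (t *: z + u0)) (delta_mx 0 i) - delta_mx 0 i)) 0 j.
  rewrite [LHS]mxE [RHS]mxE; congr (_ * _).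
  rewrite [LHS]mxE [RHS]mxE Ad_mxE; congr (_ + _).
  by rewrite !mxE eqxx eq_sym.
under eq_fun do rewrite eij; rewrite adij; apply: cvg_entry.
apply: cvg_dnbhs_at_right; exact: Ad_param_derivative.
Qed.

End AdjointMatrices.

Theorem corollary1p3 (R : realType) (n : nat) (G : lieGroupType R n)
    (a : chart R n G) (C : {vspace 'rV[R]_n}) :
  compact [set: G] ->
  atlas a -> dom a 1%g ->
  semisimple (lie_bracket a) ->
  cartan_subalgebra (lie_bracket a) C ->
  [set: 'rV[R]_n] =
    \bigcup_(g in [set: G]) (Ad a g @` killing_orth (lie_bracket a) C).
Proof.
move=> cG Aa a1 ss [_ nilC _]; apply/esym/seteqP; split=> // x _.
pose Gam := Ad_mx a @` [set: G].
have Gam1 : Gam 1%:M by exists 1%g => //; exact: Ad_mx1.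
have GamM M N : Gam M -> Gam N -> Gam (M *m N).
  by move=> [g _ <-] [h _ <-]; exists (h * g)%g => //; exact: Ad_mxM.
have GamV M : Gam M -> exists2 N, Gam N & N *m M = 1%:M.
  move=> [g _ <-]; exists (Ad_mx a g^-1%g); first by exists g^-1%g.
  by rewrite -Ad_mxM // mulgV Ad_mx1.
have Gam_compact : compact Gam.
  apply: continuous_compact cG; apply: continuous_subspaceT.
  exact: Ad_mx_continuous.
have Gam_aut M : Gam M -> forall u v,
    lie_bracket a (u *m M) (v *m M) = lie_bracket a u v *m M.
  by move=> [g _ <-] u v; rewrite !mul_Ad_mx Ad_lie_bracket.
have Gam_tangent z : exists M : R -> 'M[R]_n, (forall t, Gam (M t)) /\
    (fun t => t^-1 *: (M t - 1%:M)) @ 0^'+ --> ad (lie_bracket a) z.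
  exists (fun t => Ad_mx a (param a (t *: z + coord a 1%g))).
  by split=> [t|]; [exists (param a (t *: z + coord a 1%g))|exact: Ad_mx_tangent].
have [_ [g _ <-]] := compact_orbit_meets_orth (lie_bracket_linearr Aa a1)
  (@lie_bracketN _ _ _ a) Gam1 GamM GamV Gam_compact Gam_aut Gam_tangent ss x nilC.
rewrite mul_Ad_mx => orth; exists g^-1%g => //; exists (Ad a g x) => //.
by rewrite -AdM // mulVg Ad1.
Qed.
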